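(* Assume the setting of the context (one-dimensional exponential covariance model with monomial regressors on the fixed domain $[0,1]$, i.e. $\delta=0$): $x_j(s)=s^j$, $s\in[0,1]$, $j=1,\dots,p$. Suppose that $\mathbf Z\sim N(\mathbf X\boldsymbol\beta_0,\boldsymbol\Sigma(\boldsymbol\theta_0))$, where $\boldsymbol\beta_0=(\beta_{0,0},\dots,\beta_{0,p})'\in\mathbb R^{p+1}$ and $\boldsymbol\theta_0=(v_0^2,\sigma_0^2,\kappa_0)'\in\Theta\subseteq(0,\infty)^3$ are constant vectors. Assume that $\mathcal A=\{\varnothing,\{1\},\{1,2\},\dots,\{1,\dots,p\}\}$, that $\Theta$ is compact, and that $$\boldsymbol\theta_0+\big(0,\ \gamma(k),\ -(\sigma_0^2+\gamma(k))^{-1}\gamma(k)\kappa_0\big)'\in\Theta,\qquad k=0,1,\dots,p,$$ where $\gamma(k)=\boldsymbol\beta_0'\mathbf V_{p,p}\boldsymbol\beta_0-\boldsymbol\beta_0'\mathbf V_{p,k}\mathbf V_{k,k}^{-1}\mathbf V_{k,p}\boldsymbol\beta_0$ and $\mathbf V_{k,l}=\big(\frac1{i+j-1}\big)_{(k+1)\times(l+1)}$ (the $(k+1)\times(l+1)$ matrix with $(i,j)$ entry $1/(i+j-1)$). Then: (i) If $\lim_{n\to\infty}\tau_n=\infty$, then $\lim_{n\to\infty}P\{\hat\alpha_{\tau_n}=\varnothing\}=1$. (ii) If $\alpha^0\neq\varnothing$ and $\liminf_{n\to\infty}\tau_n>0$, then $\lim_{n\to\infty}P\{\hat\alpha_{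\tau_n}=\alpha^0\}<1$.
   Context: For each $n$, $D=[0,1]$ and data $\mathbf Z=(Z(s_1),\dots,Z(s_n))'$ are observed at sites $s_i=s_{ni}=i/n$, $i=1,\dots,n$. The covariance parameter is $\boldsymbol\theta=(v^2,\sigma^2,\kappa)'\in\Theta$ and $\boldsymbol\Sigma(\boldsymbol\theta)=\boldsymbol\Sigma_\eta+v^2\mathbf I$, where $\boldsymbol\Sigma_\eta$ has $(i,j)$ entry $\sigma^2\exp(-\kappa|s_i-s_j|)$. The number $p$ of regressors and the set $\mathcal A$ of candidate models do not depend on $n$. $\mathbf X$ is the $n\times(p+1)$ matrix with rows $(1,x_1(s_i),\dots,x_p(s_i))$; $p(\alpha)$ is the number of elements of $\alpha$; $\mathbf X(\alpha)$ consists of the column $\mathbf 1$ and the columns of $\mathbf X$ indexed by $\alpha$ ($\varnothing$ is the intercept-only model). A model $\alpha$ is correct if the true mean function $\mu_0(s)=\beta_{0,0}+\sum_{j=1}^p\beta_{0,j}x_j(s)$ can be written as $\beta_0+\sum_{j\in\alpha}\beta_jx_j(s)$ for all $s\in D$; $\mathcal A^0\subseteq\mathcal A$ is the set of correct models and $\alpha^0=\arg\min_{\alpha\in\mathcal A^0}p(\alpha)$ is the smallest correct model. $\hat{\boldsymbol\mu}(\alpha;\boldsymbol\theta)=\mathbf X(\alpha)(\mathbf X(\alpha)'\boldsymbol\Sigma^{-1}(\boldsymbol\theta)\mathbf X(\alpha))^{-1}\mathbf X(\alpha)'\boldsymbol\Sigma^{-1}(\boldsymbol\theta)\mathbf Z$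 (the inverses are assumed to exist), $$\ell(\alpha;\boldsymbol\theta)=-\tfrac n2\log(2\pi)-\tfrac12\log\det\boldsymbol\Sigma(\boldsymbol\theta)-\tfrac12(\mathbf Z-\hat{\boldsymbol\mu}(\alpha;\boldsymbol\theta))'\boldsymbol\Sigma^{-1}(\boldsymbol\theta)(\mathbf Z-\hat{\boldsymbol\mu}(\alpha;\boldsymbol\theta)),$$ and the ML estimate $\hat{\boldsymbol\theta}(\alpha)\in\Theta$ satisfies $\ell(\alpha;\hat{\boldsymbol\theta}(\alpha))=\sup_{\boldsymbol\theta\in\Theta}\ell(\alpha;\boldsymbol\theta)$. For a tuning parameter $\tau_n$, $\Gamma_{\tau_n}(\alpha)=-2\ell(\alpha;\hat{\boldsymbol\theta}(\alpha))+\tau_np(\alpha)$ (GIC) and $\hat\alpha_{\tau_n}=\arg\min_{\alpha\in\mathcal A}\Gamma_{\tau_n}(\alpha)$.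
   Formalization: In (ii) the limit of P{α̂=α⁰} need not exist when only liminf τ_n>0 is assumed (e.g. τ_n alternating between 1 and n), so the claim is stated as limsup P{α̂=α⁰}<1, which gives the stated inequality whenever the limit exists. *)

(* Defs.v *)
From HB Require Import structures.
From mathcomp Require Export all_boot all_order all_algebra.
From mathcomp Require Export all_classical all_reals all_analysis.
Export Order.TTheory GRing.Theory Num.Theory.
Export numFieldNormedType.Exports.

Set Implicit Arguments.
Unset Strict Implicit.
Unset Printing Implicit Defensive.

Local Open Scope classical_set_scope.
Local Open Scope ring_scope.

(* Z ~ N(mu, Sigma) as Z = mu + A xi with A A' = Sigma and xi a vector of
   independent standard normal variables; the product rule over all families of
   Borel sets states independence and the marginal laws at once.  Asking for xi
   on the same space as Z loses nothing for nonsingular Sigma, where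
   xi = A^-1 (Z - mu); it would be too strong a notion for singular Sigma. *)
Definition std_gaussian_vector d (T : measurableType d) (R : realType)
    (P : probability T R) (n : nat) (xi : T -> 'cV[R]_n) : Prop :=
  (forall i, measurable_fun setT (fun w => xi w i 0)) /\
  (forall B : 'I_n -> set R, (forall i, measurable (B i)) ->
     (P [set w | forall i, B i (xi w i 0%R)] =
      \prod_(i < n) normal_prob 0%R 1%R (B i))%E).

Definition gaussian_vector d (T : measurableType d) (R : realType)
    (P : probability T R) (n : nat) (Z : T -> 'cV[R]_n)
    (mu : 'cV[R]_n) (Sigma : 'M[R]_n) : Prop :=
  exists (A : 'M[R]_n) (xi : T -> 'cV[R]_n),
    [/\ A *m A^T = Sigma, std_gaussian_vector P xi &
        forall w, Z w = mu + A *m xi w].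

(* theta = (v^2, sigma^2, kappa); the components are the variances themselves. *)
Definition param (R : realType) : Type := (R * R * R)%type.

Section Model.
Variables (R : realType) (p : nat).

Definition site (n : nat) (i : 'I_n) : R := i.+1%:R / n%:R.

Definition covmx (n : nat) (theta : param R) : 'M[R]_n :=
  let: (v2, sigma2, kappa) := theta in
  \matrix_(i, j) (sigma2 * expR (- kappa * `|site i - site j|)) + v2%:M.

(* 'I_p is 0-based: x j stands for the regressor x_(j+1). *)
Variable x : 'I_p -> R -> R.

Definition regressors (n : nat) : 'M[R]_(n, p) :=
  \matrix_(i, j) x j (site i).

Definition design (n : nat) : 'M[R]_(n, 1 + p) :=
  row_mx (const_mx 1) (regressors n).

Definition design_sub (n : nat) (a : {set 'I_p}) : 'M[R]_(n, 1 + #|a|) :=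
  row_mx (const_mx 1) (colsub (fun j : 'I_#|a| => enum_val j) (regressors n)).

Definition mean_fun (beta : 'cV[R]_(p.+1)) (s : R) : R :=
  beta ord0 0 + \sum_(j < p) beta (lift ord0 j) 0 * x j s.

Definition correct (beta0 : 'cV[R]_(p.+1)) (a : {set 'I_p}) : Prop :=
  exists (b0 : R) (b : 'I_p -> R), forall s : R, 0 <= s <= 1 ->
    mean_fun beta0 s = b0 + \sum_(j in a) b j * x j s.

Definition smallest_correct (candidates : {set {set 'I_p}})
    (beta0 : 'cV[R]_(p.+1)) (a0 : {set 'I_p}) : Prop :=
  [/\ a0 \in candidates, correct beta0 a0 &
      forall a, a \in candidates -> correct beta0 a -> (#|a0| <= #|a|)%N].

Definition mu_hat (n : nat) (Z : 'cV[R]_n) (a : {set 'I_p})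
    (theta : param R) : 'cV[R]_n :=
  let X := design_sub n a in
  let Si := invmx (covmx n theta) in
  X *m invmx (X^T *m Si *m X) *m X^T *m Si *m Z.

Definition loglik (n : nat) (Z : 'cV[R]_n) (a : {set 'I_p})
    (theta : param R) : R :=
  let r := Z - mu_hat Z a theta in
  - (n%:R / 2) * ln (2 * pi) - 2^-1 * ln (\det (covmx n theta))
  - 2^-1 * (r^T *m invmx (covmx n theta) *m r) 0 0.

(* The supremum is taken in \bar R because [sup] is 0 on unbounded sets. *)
Definition is_ml (Theta : set (param R)) (n : nat) (Z : 'cV[R]_n)
    (a : {set 'I_p}) (theta : param R) : Prop :=
  Theta theta /\
  (loglik Z a theta)%:E = ereal_sup [set (loglik Z a t)%:E | t in Theta].

Definition gic (tau : R) (n : nat) (Z : 'cV[R]_n)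
    (theta_hat : {set 'I_p} -> param R) (a : {set 'I_p}) : R :=
  - 2 * loglik Z a (theta_hat a) + tau * #|a|%:R.

Definition is_gic_selection (candidates : {set {set 'I_p}}) (tau : R) (n : nat)
    (Z : 'cV[R]_n) (theta_hat : {set 'I_p} -> param R)
    (a : {set 'I_p}) : Prop :=
  a \in candidates /\
  forall a', a' \in candidates -> gic tau Z theta_hat a <= gic tau Z theta_hat a'.

End Model.

Definition monomial (R : realType) (p : nat) (j : 'I_p) (s : R) : R := s ^+ j.+1.

Definition initial_model (p : nat) (k : nat) : {set 'I_p} :=
  [set j : 'I_p | (j < k)%N]%SET.

Definition nested_models (p : nat) : {set {set 'I_p}} :=
  [set initial_model p k | k : 'I_p.+1]%SET.

(* With 0-based i and j, the entry 1 / (i + j - 1) becomes 1 / (i + j + 1). *)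
Definition Vmx (R : realType) (k l : nat) : 'M[R]_(k.+1, l.+1) :=
  \matrix_(i, j) ((i + j).+1%:R)^-1.

Definition gam (R : realType) (p : nat) (beta0 : 'cV[R]_(p.+1)) (k : nat) : R :=
  (beta0^T *m Vmx R p p *m beta0) 0 0
  - (beta0^T *m Vmx R p k *m invmx (Vmx R k k) *m Vmx R k p *m beta0) 0 0.

(* Main.v *)
From HB Require Import structures.
Require Import Defs.
From mathcomp Require Import measurable_realfun ring lra zify.

(** The log-determinant cancels when two models are compared at the same
    covariance parameter, and the maximum likelihood estimate of the larger model
    may be plugged into the smaller one.  So the gain of a model a over the empty
    model is at most the squared norm of the generalized least squares fit of a,
    maximized over Theta.  This is bounded in probability: on a fixed domain the
    vectors Sigma(theta)^-1 x^j, for theta in Theta, lie under one envelope W, made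
    of a bulk of height 1/n and two boundary layers of height 1/sqrt n and width
    sqrt n, whose sum is bounded.  The envelope comes from a maximum principle for
    the tridiagonal inverse of the exponential kernel.  Hence (i).

    For (ii), the profile likelihood of a does not change when a combination X(a) b
    is subtracted from the data, and with b the fitted coefficients the gain over the
    empty model becomes nonpositive.  These coefficients are tight, so finitely many
    b_l, in a number independent of n, suffice to bring the gain below any given
    positive constant with probability at least 1/2, after replacing Z by
    Z - X(a) b_l for some l.  The norm of X(a) b_l in the Sigma(theta0)^-1 metric is
    bounded, so the density of the shifted Gaussian law has bounded second moment
    and the event keeps a probability bounded below without the shift. *)

Set Implicit Arguments.
Unset Strict Implicit.
Unset Printing Implicit Defensive.

Local Open Scope classical_set_scope.
Local Open Scope ring_scope.

(** * Gaussian vectors *)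

Section density_measure.
Local Open Scope ereal_scope.
Context d (T : measurableType d) (R : realType).
Variables (mu : {measure set T -> \bar R}) (u : T -> R).

(** The two proofs are arguments so that the measure structure declared below can attach to the
    term. *)
Definition density_measure of measurable_fun setT u & (forall x, (0 <= u x)%R) :=
  fun A : set T => \int[mu]_(x in A) (u x)%:E.

Hypotheses (mu_u : measurable_fun setT u) (u_ge0 : forall x, (0 <= u x)%R).
Local Notation nu := (density_measure mu_u u_ge0).

Let density0 : nu set0 = 0.
Proof. by rewrite /density_measure integral_set0. Qed.

Let density_ge0 A : 0 <= nu A.
Proof. by apply: integral_ge0 => x _; rewrite lee_fin. Qed.

Let density_sigma_additive : semi_sigma_additive nu.
Proof.
move=> A mA tA mUA; rewrite /density_measure ge0_integral_bigcup//.
- apply: is_cvg_ereal_nneg_natsum_cond => n _ _.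
  by apply: integral_ge0 => /= x ?; rewrite lee_fin.
- by apply: measurable_funTS; exact/measurable_EFinP.
- by move=> x _; rewrite lee_fin.
Qed.

HB.instance Definition _ := isMeasure.Build _ _ _
  nu density0 density_ge0 density_sigma_additive.

Import HBNNSimple.

(** Simple functions increasing to [f] reduce the claim, by monotone convergence on both sides, to
    the indicators of level sets. *)
Lemma ge0_integral_density (f : T -> \bar R) :
  measurable_fun setT f -> (forall x, 0 <= f x) ->
  \int[nu]_x f x = \int[mu]_x ((u x)%:E * f x).
Proof.
move=> mf f0; pose f_ := nnsfun_approx measurableT mf.
have muE : measurable_fun setT (EFin \o u) by exact/measurable_EFinP.
have mf_ n : measurable_fun setT (fun x => (f_ n x)%:E).
  exact/measurable_EFinP.
transitivity (limn (fun n => \int[nu]_x (f_ n x)%:E)).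
  rewrite -monotone_convergence//=.
  - apply: eq_integral => x _; apply/esym/cvg_lim => //=.
    by apply: cvg_nnsfun_approx => //= y _; exact: f0.
  - by move=> n x _; rewrite lee_fin.
  - by move=> x _ a b ab; rewrite lee_fin//; exact/lefP/nd_nnsfun_approx.
transitivity (limn (fun n => \int[mu]_x ((u x)%:E * (f_ n x)%:E))); last first.
  rewrite -monotone_convergence//=.
  - apply: eq_integral => x _; apply/cvg_lim => //=.
    apply: cvgeZl => //.
    by apply: cvg_nnsfun_approx => //= y _; exact: f0.
  - by move=> n; apply: emeasurable_funM.
  - by move=> n x _; rewrite mule_ge0// lee_fin.
  - move=> x _ a b ab; rewrite lee_wpmul2l ?lee_fin//.
    exact/lefP/nd_nnsfun_approx.
congr (limn _); apply/funext => n.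
under [LHS]eq_integral do rewrite fimfunE -fsumEFin//.
rewrite [LHS]ge0_integral_fsum//; last 2 first.
  - by move=> r; exact/measurable_EFinP/measurableT_comp.
  - by move=> m x _; rewrite EFinM nnfun_muleindic_ge0.
transitivity (\int[mu]_x \sum_(k \in range (f_ n))
    ((u x)%:E * (k * \1_(f_ n @^-1` [set k]) x)%:E)).
  rewrite [RHS]ge0_integral_fsum//; last 2 first.
  - move=> r; apply: emeasurable_funM => //.
    by apply/measurable_EFinP; exact: measurableT_comp.
  - by move=> m x _; rewrite mule_ge0 ?lee_fin// -lee_fin EFinM nnfun_muleindic_ge0.
  apply: eq_fsbigr => r _.
  rewrite integralZl_indic_nnsfun//= integral_indic//= setIT.
  under [RHS]eq_integral do rewrite EFinM muleCA.
  (* A nonempty level set forces [r] to be nonnegative, as needed to take it out of the integral. *)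
  have [->|r0] := eqVneq (f_ n @^-1` [set r]) set0.
    rewrite measure0 mule0; apply/esym/integral0_eq => x _.
    by rewrite indic0 !mule0.
  have r_ge0 : (0 <= r)%R by move/set0P: r0 => [y /= <-].
  rewrite ge0_integralZl//=.
  - congr (_ * _); rewrite /density_measure integral_mkcond.
    apply: eq_integral => x _; rewrite patchE indicE; case: ifPn => _.
      by rewrite mule1.
    by rewrite mule0.
  - apply: emeasurable_funM => //; exact/measurable_EFinP.
  - by move=> x _; rewrite mule_ge0 ?lee_fin.
apply: eq_integral => x _.
rewrite [in RHS]fimfunE -fsumEFin// ge0_mule_fsumr//.
by move=> k; rewrite EFinM nnfun_muleindic_ge0.
Qed.

End density_measure.

Section product_formula.
Context d (T : measurableType d) (R : realType) (P : probability T R).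

(** The hypothesis on indicators says that the image under [v] of the measure with density [u] is
    [c nu], so the integrals of [g] agree. *)
Lemma ge0_integral_factor (nu : {measure set (measurableTypeR R) -> \bar R})
    (u : T -> R) (v : T -> measurableTypeR R) (c : R) :
  measurable_fun setT u -> (forall w, 0 <= u w) -> measurable_fun setT v ->
  0 <= c ->
  (forall B : set (measurableTypeR R), measurable B ->
     (\int[P]_w (u w * \1_B (v w))%:E = c%:E * nu B)%E) ->
  forall g : measurableTypeR R -> R, measurable_fun setT g -> (forall x, 0 <= g x) ->
  (\int[P]_w (u w * g (v w))%:E = c%:E * \int[nu]_x (g x)%:E)%E.
Proof.
move=> mu u0 mv c0 H g mg g0.
under eq_integral do rewrite EFinM.
pose nU : {measure set T -> \bar R} := density_measure P mu u0.
have mgE : measurable_fun setT (EFin \o g) by exact/measurable_EFinP.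
rewrite -(@ge0_integral_density _ _ _ P u mu u0 (fun w => (g (v w))%:E)); last 2 first.
- by apply: (measurableT_comp mgE mv).
- by move=> x; rewrite lee_fin.
rewrite -(setTI setT) -[X in _ `&` X](preimage_setT v) setTI.
rewrite -(@ge0_integral_pushforward _ _ _ _ _ v mv nU setT (EFin \o g))//; last first.
  by move=> y _; rewrite /= lee_fin.
transitivity (\int[mscale (NngNum c0) nu]_y (g y)%:E)%E; last first.
  by rewrite ge0_integral_mscale// => x _; rewrite lee_fin.
apply: eq_measure_integral => A mA _; rewrite /= /mscale/= -H//.
rewrite /pushforward /density_measure [LHS]integral_mkcond; apply: eq_integral => x _.
rewrite patchE indicE.
have -> : (x \in v @^-1` A) = (v x \in A) by [].
by case: ifPn => _; rewrite ?mulr1 ?mulr0.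
Qed.

Variables (n : nat) (xi : T -> 'cV[R]_n).
Hypothesis xiP : std_gaussian_vector P xi.

Lemma measurable_gaussian_coord i : measurable_fun setT (fun w => xi w i 0).
Proof. by case: xiP. Qed.

Lemma expectation_prod_gaussian (g : 'I_n -> R -> R) (a : 'I_n -> R) :
  (forall i, measurable_fun setT (g i)) -> (forall i x, 0 <= g i x) ->
  (forall i, \int[normal_prob 0%R 1%R]_x (g i x)%:E = (a i)%:E)%E ->
  (\int[P]_w (\prod_i g i (xi w i 0%R))%:E = (\prod_i a i)%:E)%E.
Proof.
move=> mg g0 ga.
have a0 i : 0 <= a i.
  by rewrite -lee_fin -ga; apply: integral_ge0 => x _; rewrite lee_fin.
(* Independence is given for indicators only. The first [j] of them are replaced by [g], one
   coordinate at a time; [B] stays quantified because the next replacement needs the statement for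
   every set in coordinate [j]. *)
suff H : forall (j : nat), (j <= n)%N -> forall B : 'I_n -> set R,
    (forall i, measurable (B i)) ->
    let h (i : 'I_n) := if (i < j)%N then g i else \1_(B i) in
    let b (i : 'I_n) := if (i < j)%N then a i else fine (normal_prob 0 1 (B i)) in
    (\int[P]_w (\prod_i h i (xi w i 0%R))%:E = (\prod_i b i)%:E)%E.
  have := H n (leqnn n) (fun=> setT) (fun=> measurableT) => /=.
  under eq_integral do (under eq_bigr do rewrite ltn_ord).
  by under [in X in _ = X -> _]eq_bigr do rewrite ltn_ord.
elim => [_ B mB h b|j IH jn B mB h b].
  rewrite (eq_integral (EFin \o \1_([set w | forall i, B i (xi w i 0%R)]))); last first.
    move=> w _ /=; congr EFin; rewrite /h indicE; case: (boolP (w \in _)).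
      by rewrite in_setE /= => Bw; rewrite big1// => i _; rewrite indicE mem_set.
    rewrite notin_setE /= => /existsNP[i Bi].
    by rewrite (bigD1 i)//= indicE memNset// mul0r.
  rewrite integral_indic//; last first.
    rewrite (_ : [set _ | _] = \bigcap_(i in [set: 'I_n]) ((fun w => xi w i 0%R) @^-1` B i)).
      apply: fin_bigcap_measurable => // i _.
      by rewrite -[X in measurable X]setTI; exact: measurable_gaussian_coord.
    by apply/seteqP; split => [w Bw i _|w Bw i]; exact: Bw.
  rewrite setIT; transitivity (\prod_(i < n) normal_prob 0%R 1%R (B i))%E; first exact: (proj2 xiP B mB).
  rewrite -prodEFin; apply: eq_bigr => i _.
  by rewrite /b/= fineK//; apply: (fin_num_measure (normal_prob 0 1)); exact: mB.
pose i0 := Ordinal jn.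
pose U w := \prod_(i | i != i0) h i (xi w i 0).
have mh i : measurable_fun setT (h i).
  by rewrite /h; case: ifP => // _; exact: measurable_indic.
have h0 i x : 0 <= h i x by rewrite /h; case: ifP.
have mU : measurable_fun setT U.
  rewrite (_ : U = fun w => \prod_i (if i != i0 then h i (xi w i 0) else 1)); last first.
    by apply/funext => w; exact: big_mkcond.
  apply: measurable_prod => i _; case: (i != i0) => //.
  exact: (measurableT_comp (mh i) (measurable_gaussian_coord i)).
have b0 i : 0 <= b i by rewrite /b; case: ifP => // _; rewrite fine_ge0.
transitivity (\int[P]_w (U w * g i0 (xi w i0 0%R))%:E)%E.
  by apply: eq_integral => w _; rewrite (bigD1 i0)//= {1}/h ltnSn mulrC.
rewrite (@ge0_integral_factor (normal_prob 0 1) U (fun w => xi w i0 0)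
  (\prod_(i | i != i0) b i) mU)//.
- by rewrite ga [in RHS](bigD1 i0)//= {2}/b /= ltnSn mulrC.
- by move=> w; exact: prodr_ge0.
- exact: measurable_gaussian_coord.
- exact: prodr_ge0.
2: exact: mg.
move=> C mC.
pose B' i := if i == i0 then C else B i.
have mB' i : measurable (B' i) by rewrite /B'; case: ifP => _; [exact: mC|exact: mB].
have B'0 : B' i0 = C by rewrite /B' eqxx.
have B'E i : i != i0 -> B' i = B i by rewrite /B' => /negbTE ->.
have lt_j i : i != i0 -> (i < j)%N = (i < j.+1)%N.
  by rewrite ltnS [in RHS]leq_eqVlt -val_eqE /= => /negbTE ->.
have := IH (ltnW jn) B' mB'; rewrite /=.
rewrite [in X in _ = X -> _](bigD1 i0)//= ltnn B'0 EFinM fineK; last first.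
  exact: (fin_num_measure (normal_prob 0 1)).
rewrite (eq_bigr b) => [|i ii0]; last by rewrite /b lt_j// B'E.
rewrite muleC => <-; apply: eq_integral => w _; congr EFin.
rewrite [RHS](bigD1 i0)//= ltnn B'0 mulrC; congr (_ * _).
by apply: eq_bigr => i ii0; rewrite /h lt_j// B'E.
Qed.

End product_formula.

(** * Translations of the standard normal law *)

Section gaussian_1d.
Variable R : realType.

Lemma lebesgue_measure_translate (h : R) (A : set R) : measurable A ->
  pushforward lebesgue_measure ((fun x => x + h) : measurableTypeR R -> measurableTypeR R) A =
  lebesgue_measure A.
Proof.
move=> mA.
have mh : measurable_fun setT ((fun x => x + h) : measurableTypeR R -> measurableTypeR R).
  exact: measurable_funD.
apply/esym/lebesgue_measure_unique => //= _ [[a b]] _ <-.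
rewrite /pushforward.
have -> : (fun x => x + h) @^-1` `]a, b] = `](a - h), (b - h)]%classic :> set R.
  by apply/seteqP; split => x /=; rewrite !in_itv/= ltrBlDr lerBrDr.
by rewrite /= !lebesgue_measure_itv/= !lte_fin ltrBlDr subrK !EFinN; case: ifP => // _; rewrite -!EFinB; congr EFin; ring.
Qed.

Lemma normal_pdf_translate (h x : R) :
  normal_pdf 0 1 (x - h) = expR (h * x - h ^+ 2 / 2) * normal_pdf 0 1 x.
Proof.
rewrite !normal_pdfE ?oner_neq0//.
rewrite mulrCA; congr (_ * _); rewrite /normal_fun -expRD; congr expR.
by rewrite !subr0 expr1n; field.
Qed.

(** Cameron-Martin formula in dimension one: the weight turns the standard density into the one
    centred at [h], and Lebesgue measure is invariant under translation. *)
Lemma normal_prob_translate (h : R) (B : set R) : measurable B ->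
  (\int[normal_prob 0%R 1%R]_x (\1_B x * expR (h * x - h ^+ 2 / 2)%R)%:E =
   normal_prob 0%R 1%R ((fun x => x + h)%R @^-1` B))%E.
Proof.
move=> mB.
have mpdf := measurable_normal_pdf (0 : R) 1.
have pdf0 := @normal_pdf_ge0 R 0 1.
transitivity (\int[density_measure lebesgue_measure mpdf pdf0]_x
   (\1_B x * expR (h * x - h ^+ 2 / 2)%R)%:E)%E => //.
have mexp : measurable_fun setT (fun x : R => expR (h * x - h ^+ 2 / 2)).
  by apply: measurableT_comp => //; apply: measurable_funB => //; exact: measurable_funM.
rewrite ge0_integral_density; last 2 first.
- by apply/measurable_EFinP; apply: measurable_funM => //; exact: measurable_indic.
- by move=> x; rewrite lee_fin mulr_ge0// expR_ge0.
pose f (x : measurableTypeR R) : \bar R := (normal_pdf 0 1 (x - h))%:E.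
transitivity (\int[lebesgue_measure]_(x in B) f x)%E.
  rewrite [RHS]integral_mkcond; apply: eq_integral => x _.
  rewrite patchE indicE; case: ifPn => _; rewrite ?mul0r ?mule0 ?mul1r//.
  by rewrite /f normal_pdf_translate -EFinM mulrC.
have mh : measurable_fun setT ((fun x => x + h) : measurableTypeR R -> measurableTypeR R).
  exact: measurable_funD.
have mf : measurable_fun setT f.
  by apply/measurable_EFinP; apply: measurableT_comp => //; exact: measurable_funB.
transitivity (\int[pushforward lebesgue_measure ((fun x => (x + h)%R) : measurableTypeR R -> measurableTypeR R)]_(x in B) f x)%E.
  apply: eq_measure_integral => A mA _; 
  exact/esym/lebesgue_measure_translate.
rewrite ge0_integral_pushforward//.
- rewrite /normal_prob; apply: eq_integral => x _.
  by rewrite /f /= addrK.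
- exact: measurable_funTS.
- by move=> x _; rewrite lee_fin normal_pdf_ge0.
Qed.

Lemma integral_expR_normal (h : R) :
  (\int[normal_prob 0%R 1%R]_x (expR (h * x)%R)%:E = (expR (h ^+ 2 / 2)%R)%:E)%E.
Proof.
have := @normal_prob_translate h setT measurableT.
rewrite preimage_setT.
have -> : normal_prob (0 : R) 1 setT = 1%E by exact: probability_setT.
move=> E.
transitivity ((expR (h ^+ 2 / 2)%R)%:E * \int[normal_prob 0%R 1%R]_x
  (\1_setT x * expR (h * x - h ^+ 2 / 2)%R)%:E)%E; last by rewrite E mule1.
rewrite -ge0_integralZl//.
- by apply: eq_integral => x _; rewrite indicT mul1r -EFinM -expRD subrKC.
- apply/measurable_EFinP; apply: measurable_funM => //.
  by apply: measurableT_comp => //; apply: measurable_funB => //; exact: measurable_funM.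
Qed.

End gaussian_1d.

(** A pi-system on which independence is stated directly; the sigma-algebra it generates contains
    the open sets, by [open_boxes]. *)
Definition boxes (R : realType) (n : nat) : set (set 'cV[R]_n) :=
  [set [set z : 'cV[R]_n | forall i, B i (z i 0)]
     | B in [set B : 'I_n -> set R | forall i, measurable (B i)]].

Section gaussian_shift.
Context d (T : measurableType d) (R : realType) (P : probability T R).
Variables (n : nat).

Lemma measurable_box_preimage (xi : T -> 'cV[R]_n) (G : set 'cV[R]_n) :
  (forall i, measurable_fun setT (fun w => xi w i 0)) ->
  <<s @boxes R n >> G -> measurable (xi @^-1` G).
Proof.
move=> mxi; apply: (@smallest_sub _ _ _ [set G | measurable (xi @^-1` G)]) => //=.
  split => [|A mA|F mF]; rewrite /= ?preimage_set0//.
  - rewrite setTD preimage_setC; apply: measurableC; exact: mA.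
  - by rewrite preimage_bigcup; apply: bigcup_measurable => k _; exact: mF.
move=> _ [B mB <-]; rewrite /=.
rewrite (_ : _ @^-1` _ = \bigcap_(i in [set: 'I_n]) ((fun w => xi w i 0%R) @^-1` B i)).
  apply: fin_bigcap_measurable => // i _.
  by rewrite -[X in measurable X]setTI; exact: mxi.
by apply/seteqP; split => [w Bw i _|w Bw i]; exact: Bw.
Qed.

Variable xi : T -> 'cV[R]_n.
Hypothesis xiP : std_gaussian_vector P xi.

Let mxi i : measurable_fun setT (fun w => xi w i 0) := measurable_gaussian_coord xiP i.

(** Likelihood ratio of [xi + h] against [xi], evaluated at [xi w]. *)
Definition shift_density (h : 'cV[R]_n) (w : T) : R :=
  \prod_i expR (h i 0 * xi w i 0 - h i 0 ^+ 2 / 2).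

Let mexp (a b : R) : measurable_fun setT (fun x : R => expR (a * x - b)).
Proof.
apply: measurableT_comp => //; apply: measurable_funB => //.
Qed.

Lemma shift_density_ge0 h w : 0 <= shift_density h w.
Proof. by apply: prodr_ge0 => i _; exact: expR_ge0. Qed.

Lemma measurable_shift_density h : measurable_fun setT (shift_density h).
Proof.
by apply: measurable_prod => i _; exact: (measurableT_comp (mexp _ _) (mxi i)).
Qed.

(** Cameron-Martin formula in dimension [n]. Both sides are measures of [G]; they agree on boxes by
    independence and the one-dimensional formula, hence on the generated sigma-algebra. *)
Lemma shift_densityP h (G : set 'cV[R]_n) : <<s @boxes R n >> G ->
  (\int[P]_(w in xi @^-1` G) (shift_density h w)%:E =
   P [set w | G (xi w + h)%R])%E.
Proof.
pose X := g_sigma_algebraType (@boxes R n).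
pose mh := measurable_shift_density h; pose h0 := @shift_density_ge0 h.
pose nu1 : {measure set T -> \bar R} := density_measure P mh h0.
have mxiX : measurable_fun setT (xi : T -> X).
  by move=> _ Y mY; rewrite setTI; apply: measurable_box_preimage.
have mxihX : measurable_fun setT ((fun w => xi w + h) : T -> X).
  move=> _ Y mY; rewrite setTI; apply: measurable_box_preimage => // i.
  by under eq_fun do rewrite mxE; exact: measurable_funD.
move=> GB.
pose m1 : {measure set X -> \bar R} :=
  measure_function_pushforward__canonical__measure_function_Measure nu1 mxiX.
pose m2 : {measure set X -> \bar R} :=
  measure_function_pushforward__canonical__measure_function_Measure P mxihX.
have boxT : @boxes R n setT.
  by exists (fun=> setT) => //=; apply/seteqP; split.
have boxI : setI_closed (@boxes R n).
  move=> _ _ [B mB <-] [C mC <-]; exists (fun i => B i `&` C i).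
    by move=> i; exact: measurableI.
  apply/seteqP; split => [z /= BC|z [/= Bz Cz] i]; last by split.
  by split=> i; case: (BC i).
have m1E (B : 'I_n -> set R) : (forall i, measurable (B i)) ->
    m1 [set z : 'cV[R]_n | forall i, B i (z i 0)] = m2 [set z : 'cV[R]_n | forall i, B i (z i 0)].
  move=> mB.
  rewrite /m1 /m2 /= /pushforward /nu1 /density_measure.
  transitivity (\prod_i normal_prob 0%R 1%R ((fun x => x + h i 0)%R @^-1` B i))%E; last first.
    rewrite -(proj2 xiP)//; last first.
      by move=> i; rewrite -[X in measurable X]setTI; exact: measurable_funD.
    by congr (P _); apply/seteqP; split => w /= Bw i; have := Bw i; rewrite mxE.
  transitivity (\int[P]_w (\prod_i (\1_(B i) (xi w i 0%R) *
      expR (h i 0 * xi w i 0 - h i 0 ^+ 2 / 2)%R)%R)%:E)%E.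
    rewrite integral_mkcond; apply: eq_integral => w _; rewrite patchE.
    case: ifPn => [|]; rewrite ?in_setE ?notin_setE /= => Bw.
      congr EFin; apply: eq_bigr => i _.
      by rewrite indicE mem_set ?mul1r//; exact: Bw.
    move/existsNP : Bw => [i Bi].
    by rewrite (bigD1 i)//= indicE memNset// !mul0r.
  rewrite (@expectation_prod_gaussian _ _ _ P n xi xiP
    (fun i x => \1_(B i) x * expR (h i 0 * x - h i 0 ^+ 2 / 2))
    (fun i => fine (normal_prob 0 1 ((fun x => x + h i 0)%R @^-1` B i)))).
  - rewrite -prodEFin; apply: eq_bigr => i _; rewrite fineK//.
    apply: (fin_num_measure (normal_prob 0 1)).
    by rewrite -[X in measurable X]setTI; exact: measurable_funD.
  - by move=> i; apply: measurable_funM => //; exact: measurable_indic.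
  - by move=> i x; rewrite mulr_ge0// expR_ge0.
  - move=> i; rewrite normal_prob_translate// fineK//.
    apply: (fin_num_measure (normal_prob 0 1)).
    by rewrite -[X in measurable X]setTI; exact: measurable_funD.
rewrite -[LHS]/(m1 G) -[RHS]/(m2 G).
apply: (@measure_unique _ R X (@boxes R n) (fun=> setT)) => //.
- by rewrite bigcup_const.
- by move=> _ [B mB <-]; exact: m1E.
- move=> _; have := m1E (fun=> setT) (fun=> measurableT).
  rewrite (_ : [set _ | _] = setT); last by apply/seteqP; split.
  move=> ->; rewrite /m2 /= /pushforward preimage_setT.
  by rewrite probability_setT ltry.
Qed.

End gaussian_shift.

Section gaussian_vector_bounds.
Context d (T : measurableType d) (R : realType) (P : probability T R).
Variables (n : nat) (xi : T -> 'cV[R]_n).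
Hypothesis xiP : std_gaussian_vector P xi.

Let mexp (a b : R) : measurable_fun setT (fun x : R => expR (a * x - b)).
Proof. by apply: measurableT_comp => //; exact: measurable_funB. Qed.

(** Factor by factor: [expR (2 h x - h^2)] has mean [expR (2 h^2 - h^2)]. *)
Lemma shift_density_sqr (h : 'cV[R]_n) :
  (\int[P]_w (shift_density xi h w ^+ 2)%:E = (expR (\sum_i h i 0 ^+ 2)%R)%:E)%E.
Proof.
rewrite (_ : expR _ = \prod_i expR (h i 0 ^+ 2)); last by rewrite expR_sum.
rewrite -(@expectation_prod_gaussian _ _ _ P n xi xiP
  (fun i x => expR (2 * h i 0 * x - h i 0 ^+ 2))) //.
- apply: eq_integral => w _; rewrite /shift_density -prodrXl; congr EFin.
  by apply: eq_bigr => i _; rewrite expr2 -expRD; congr expR; field.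
- move=> i; under eq_integral do rewrite expRD EFinM muleC.
  rewrite ge0_integralZl//.
  + by rewrite integral_expR_normal -EFinM -expRD; congr (expR _)%:E; field.
  + by apply/measurable_EFinP; apply: measurableT_comp => //; exact: measurable_funM.
Qed.

(** The left side integrates the likelihood ratio [D] over the unshifted event, and
    [D <= lam + D^2 / lam]. Quantitative contiguity: a shift of bounded norm cannot make a very
    unlikely event likely. *)
Lemma gaussian_shift_le (h : 'cV[R]_n) (G : set 'cV[R]_n) (lam : R) :
  <<s @boxes R n >> G -> 0 < lam ->
  (P [set w | G (xi w + h)%R] <=
   lam%:E * P (xi @^-1` G) + (expR (\sum_i h i 0 ^+ 2)%R / lam)%:E)%E.
Proof.
move=> mG lam0; rewrite -(shift_densityP xiP h mG).
have mxiG : measurable (xi @^-1` G).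
  by apply: measurable_box_preimage mG; exact: measurable_gaussian_coord xiP.
have mD := measurable_shift_density xiP h.
have D0 := @shift_density_ge0 _ _ _ n xi h.
apply: (@le_trans _ _ (\int[P]_(w in xi @^-1` G)
  (lam%:E + (lam^-1 * shift_density xi h w ^+ 2)%:E))%E).
  apply: ge0_le_integral => //.
  - by move=> w _; rewrite lee_fin.
  - by apply/measurable_EFinP; exact: measurable_funTS.
  - apply/measurable_EFinP; apply: measurable_funTS.
    by apply: measurable_funD => //; apply: measurable_funM => //; exact: measurable_funX.
  - move=> w _; rewrite -EFinD lee_fin -(ler_pM2l lam0) mulrDr mulrA divff ?gt_eqF// mul1r.
    by nra.
rewrite ge0_integralD//; last 3 first.
- by move=> w _; rewrite lee_fin ltW.
- by move=> w _; rewrite lee_fin mulr_ge0// ?sqr_ge0// invr_ge0 ltW.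
- by apply/measurable_EFinP; apply: measurable_funTS; apply: measurable_funM => //; exact: measurable_funX.
rewrite integral_cst//; apply: leeD => //.
rewrite mulrC EFinM -(shift_density_sqr h) -ge0_integralZl//; last 3 first.
- by apply/measurable_EFinP; exact: measurable_funX.
- by move=> w _; rewrite lee_fin sqr_ge0.
- by rewrite lee_fin invr_ge0 ltW.
apply: ge0_subset_integral => //.
- by apply/measurable_EFinP; apply: measurable_funM => //; exact: measurable_funX.
- by move=> w _; rewrite lee_fin mulr_ge0// ?sqr_ge0// invr_ge0 ltW.
Qed.

(** From [|s| <= e^s + e^-s] and the exponential moments for [a] and [- a]; a crude bound suffices,
    as only boundedness matters later. *)
Lemma gaussian_linear_abs_le (a : 'cV[R]_n) :
  (\int[P]_w `|\sum_i a i 0 * xi w i 0|%:E <=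
   (2 * expR ((\sum_i a i 0 ^+ 2)%R / 2)%R)%:E)%E.
Proof.
have mxi i : measurable_fun setT (fun w => xi w i 0) := measurable_gaussian_coord xiP i.
have H (b : 'cV[R]_n) : (\int[P]_w (expR (\sum_i b i 0 * xi w i 0)%R)%:E =
    (expR ((\sum_i b i 0 ^+ 2)%R / 2)%R)%:E)%E.
  rewrite (_ : expR _ = \prod_i expR (b i 0 ^+ 2 / 2)); last by rewrite mulr_suml expR_sum.
  rewrite -(@expectation_prod_gaussian _ _ _ P n xi xiP (fun i x => expR (b i 0 * x))).
  - by apply: eq_integral => w _; rewrite expR_sum.
  - by move=> i; apply: measurableT_comp => //; exact: measurable_funM.
  - by move=> i x; exact: expR_ge0.
  - by move=> i; exact: integral_expR_normal.
have mS (b : 'cV[R]_n) : measurable_fun setT (fun w => \sum_i b i 0 * xi w i 0).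
  by apply: measurable_sum => i; exact: measurable_funM.
have mE (b : 'cV[R]_n) : measurable_fun setT (fun w => expR (\sum_i b i 0 * xi w i 0)).
  exact: measurableT_comp.
rewrite mulr_natl mulr2n EFinD -{1}(H a).
have -> : \sum_i a i 0 ^+ 2 = \sum_i (- a) i 0 ^+ 2.
  by apply: eq_bigr => i _; rewrite mxE sqrrN.
rewrite -(H (- a)) -ge0_integralD//.
- apply: ge0_le_integral => //.
  + by apply/measurable_EFinP; exact: measurableT_comp.
  + by apply/measurable_EFinP; exact: measurable_funD.
  move=> w _; rewrite -EFinD lee_fin.
  rewrite [X in _ + expR X](_ : _ = - \sum_i a i 0 * xi w i 0); last first.
    by rewrite -sumrN; apply: eq_bigr => i _; rewrite mxE mulNr.
  set s := \sum_i _.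
  have := expR_ge1Dx s; have := expR_ge1Dx (- s).
  have := expR_gt0 s; have := expR_gt0 (- s).
  by move=> *; rewrite ler_norml; apply/andP; split; lra.
- exact/measurable_EFinP.
- exact/measurable_EFinP.
Qed.

End gaussian_vector_bounds.

(** An open set is the union of the countably many cubes with rational centre and radius [1/(k+1)]
    that it contains. *)
Lemma open_boxes (R : realType) (n : nat) (G : set 'cV[R]_n) :
  open G -> <<s @boxes R n >> G.
Proof.
move=> oG; pose X := g_sigma_algebraType (@boxes R n).
pose B (qk : 'cV[rat]_n * nat) : set X :=
  [set z : 'cV[R]_n | forall i, `|z i 0 - ratr (qk.1 i 0)| < qk.2.+1%:R^-1].
pose I := [set qk | B qk `<=` G].
have -> : G = \bigcup_qk (if pselect (I qk) then B qk else set0).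
  apply/seteqP; split => [z Gz|z [qk _]]; last by case: pselect => // Iqk; apply: Iqk.
  have /nbhs_ballP[e /= e0 zeG] : nbhs z G by rewrite nbhsE; exists G.
  (* The radius is below [e/2], since [z] and the points of the cube are each within one radius of
     the centre. *)
  pose k := Num.truncn (2 / e).
  have kP : 2 * k.+1%:R^-1 < e.
    by rewrite ltr_pdivrMr ?ltr0n// -ltr_pdivrMl// mulrC truncnS_gt.
  have [q qP] : exists q : 'I_n -> rat, forall i, `|z i 0 - ratr (q i)| < k.+1%:R^-1.
    suff /boolp.choice[q qP] : forall i, exists q : rat, `|z i 0 - ratr q| < k.+1%:R^-1.
      by exists q.
    move=> i.
    have /rat_in_itvoo[q] : z i 0 - k.+1%:R^-1 < z i 0 + k.+1%:R^-1.
      by rewrite ltrD2l gtrN// invr_gt0.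
    by rewrite in_itv/= => /andP[q1 q2]; exists q; move: (k.+1%:R^-1) q1 q2 => c q1 q2;
      rewrite ltr_norml; apply/andP; split; lra.
  exists (\col_i q i, k) => //.
  case: pselect => [? /=|]; first by move=> i /=; rewrite mxE.
  move=> nI; case: nI => y yB; apply: zeG; split => // i j; rewrite ord1 /ball/= (le_lt_trans _ kP)//.
  have := yB i; rewrite /= mxE => yi; have zi := qP i.
  rewrite -[leLHS]/(`|z i 0 - y i 0|).
  have -> : z i 0 - y i 0 = (z i 0 - ratr (q i)) - (y i 0 - ratr (q i)) by ring.
  by rewrite (le_trans (ler_normB _ _))// mulr_natl mulr2n lerD// ltW.
apply: (@countable_bigcupT_measurable _ X) => // qk.
case: pselect => [?|?] /=; last exact: measurable0.
apply: sub_sigma_algebra.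
exists (fun i => [set x : R | `|x - ratr (qk.1 i 0)| < qk.2.+1%:R^-1]) => // i.
rewrite (_ : [set _ | _] = ball (ratr (qk.1 i 0) : R) qk.2.+1%:R^-1).
  exact: measurable_ball.
by apply/seteqP; split => x /=; rewrite distrC.
Qed.

(** * Generalized least squares *)

Definition qform (R : realType) (n : nat) (M : 'M[R]_n) (u : 'cV[R]_n) : R :=
  (u^T *m M *m u) 0 0.

Definition posdef (R : realType) (n : nat) (M : 'M[R]_n) : Prop :=
  M^T = M /\ forall u, u != 0 -> 0 < qform M u.

Section posdef.
Variables (R : realType) (n : nat).
Implicit Types (M : 'M[R]_n) (u v : 'cV[R]_n).

Lemma qform0 M : qform M 0 = 0.
Proof. by rewrite /qform mulmx0 mxE. Qed.

Lemma posdef_ge0 M u : posdef M -> 0 <= qform M u.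
Proof.
by case=> _ H; have [->|/H/ltW//] := eqVneq u 0; rewrite qform0.
Qed.

Lemma posdef_unitmx M : posdef M -> M \in unitmx.
Proof.
case=> _ H; rewrite unitmxE unitfE; apply/negP => /eqP/eqP/det0P[v v0 vM].
have := H v^T; rewrite trmx_eq0 => /(_ v0).
by rewrite /qform trmxK vM mul0mx mxE ltxx.
Qed.

Lemma posdef_invmx M : posdef M -> posdef (invmx M).
Proof.
move=> pM; have uM := posdef_unitmx pM; case: (pM) => sM H; split.
  by rewrite trmx_inv sM.
move=> u u0; have := H (invmx M *m u).
rewrite /qform trmx_mul trmx_inv sM -!mulmxA mulKVmx//; apply.
apply: contra_neq u0 => /(congr1 (mulmx M)).
by rewrite mulKVmx// mulmx0.
Qed.

Lemma bilinear_formC M u v : M^T = M -> (u^T *m M *m v) 0 0 = (v^T *m M *m u) 0 0.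
Proof.
move=> sM; transitivity ((v^T *m M *m u)^T 0 0); last by rewrite mxE.
by rewrite !trmx_mul trmxK sM mulmxA.
Qed.

Lemma qformB M u v : M^T = M ->
  qform M (u - v) = qform M u - 2 * (v^T *m M *m u) 0 0 + qform M v.
Proof.
move=> sM; rewrite /qform [(u - v)^T]linearB /= !mulmxBr !mulmxBl.
have := bilinear_formC u v sM.
rewrite !mxE; lra.
Qed.

End posdef.

Section generalized_least_squares.
Variables (R : realType) (n r : nat) (V : 'M[R]_n) (X : 'M[R]_(n, r)).

Definition gls_coef (z : 'cV[R]_n) : 'cV[R]_r :=
  invmx (X^T *m V *m X) *m X^T *m V *m z.

Local Notation H := (X^T *m V *m X).
Hypotheses (sV : V^T = V) (uH : H \in unitmx).

Lemma gls_normal_eq z : H *m gls_coef z = X^T *m V *m z.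
Proof.
have -> : gls_coef z = invmx H *m (X^T *m V *m z) by rewrite /gls_coef !mulmxA.
by rewrite mulKVmx.
Qed.

Lemma gls_coef_shift z b : gls_coef (z - X *m b) = gls_coef z - b.
Proof.
rewrite /gls_coef mulmxBr; congr (_ - _).
transitivity (invmx H *m (H *m b)); first by rewrite !mulmxA.
by rewrite mulKmx.
Qed.

(** By the normal equations the residual is [V]-orthogonal to the columns of [X], so the cross term
    vanishes. *)
Lemma gls_pythagoras z b :
  qform V (z - X *m b) = qform V (z - X *m gls_coef z) + qform H (b - gls_coef z).
Proof.
set g := gls_coef z.
have -> : z - X *m b = (z - X *m g) - X *m (b - g).
  by rewrite mulmxBr opprB addrA subrK.
rewrite qformB//.
have -> : (X *m (b - g))^T *m V *m (z - X *m g) = 0.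
  rewrite trmx_mul; transitivity ((b - g)^T *m (X^T *m V *m z - H *m g)).
    by rewrite !mulmxBr !mulmxA.
  by rewrite gls_normal_eq subrr mulmx0.
rewrite mxE mulr0 subr0; congr (_ + _).
by rewrite /qform trmx_mul !mulmxA.
Qed.

End generalized_least_squares.

(** * The exponential covariance matrix *)

Section geometric_kernel.
Variables (R : realType) (rho : R).

(** One of the two truncated differences is 0, so the exponent is [|i - j|]. *)
Definition geo (i j : nat) : R := rho ^+ ((i - j) + (j - i)).

Lemma geoC i j : geo i j = geo j i.
Proof. by rewrite /geo addnC. Qed.

Lemma geo_le1 i j : 0 <= rho <= 1 -> 0 <= geo i j <= 1.
Proof. by move=> /andP[r0 r1]; rewrite exprn_ge0//= exprn_ile1. Qed.

(* [s] is the state of the autoregression with innovations [z]: the kernel sum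
   over the first [n] points is at least [s n ^+ 2]. *)
Lemma geo_psd (z : nat -> R) n : 0 <= rho <= 1 ->
  0 <= \sum_(i < n) \sum_(j < n) z i * z j * geo i j.
Proof.
move=> /andP[r0 r1]; pose s := fix s k := if k is k'.+1 then rho * s k' + z k' else 0.
have sE k : \sum_(i < k) z i * geo i k = rho * s k.
  elim: k => [|k IH]; first by rewrite big_ord0 mulr0.
  rewrite big_ord_recr /=.
  have -> : \sum_(i < k) z i * geo i k.+1 = rho * \sum_(i < k) z i * geo i k.
    rewrite mulr_sumr; apply: eq_bigr => i _.
    have ik := ltnW (ltn_ord i).
    rewrite mulrCA; congr (_ * _); rewrite /geo.
    rewrite (_ : (i - k = 0)%N); last by apply/eqP; rewrite subn_eq0.
    rewrite (_ : (i - k.+1 = 0)%N); last by apply/eqP; rewrite subn_eq0 ltnW.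
    by rewrite !add0n subSn// exprS.
  have -> : geo k k.+1 = rho by rewrite /geo subSnn -addn1 subnDA subnn sub0n.
  by rewrite IH; ring.
apply: (@le_trans _ _ (s n ^+ 2)); first exact: sqr_ge0.
elim: n => [|n IH]; first by rewrite big_ord0 /= expr0n.
rewrite big_ord_recr /=.
under eq_bigr do rewrite big_ord_recr /=.
rewrite big_split/= big_ord_recr /=.
have -> : \sum_(i < n) z i * z n * geo i n = z n * (rho * s n).
  by rewrite -sE mulr_sumr; apply: eq_bigr => i _; ring.
have -> : \sum_(i < n) z n * z i * geo n i = z n * (rho * s n).
  by rewrite -sE mulr_sumr; apply: eq_bigr => i _; rewrite geoC; ring.
have -> : geo n n = 1 by rewrite /geo subnn.
have rr : rho ^+ 2 <= 1 by rewrite exprn_ile1.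
have := mulr_ge0 (sqr_ge0 (s n)) (_ : 0 <= 1 - rho ^+ 2).
rewrite subr_ge0 => /(_ rr).
move=> H; rewrite mulr1; move: IH; set Q := \sum_(i < n) _ => IH.
have -> : (rho * s n + z n) ^+ 2 = s n ^+ 2 - s n ^+ 2 * (1 - rho ^+ 2) + z n * (rho * s n) + (z n * (rho * s n) + z n * z n) by ring.
by rewrite !lerD2r (le_trans _ IH)// gerBl.
Qed.

(** The kernel has entries in [[0, 1]], and [|z i z j|] is at most the mean of the two squares. *)
Lemma geo_sum_le (z : nat -> R) n : 0 <= rho <= 1 ->
  \sum_(i < n) \sum_(j < n) z i * z j * geo i j <= n%:R * \sum_(i < n) z i ^+ 2.
Proof.
move=> r01.
apply: (@le_trans _ _ (\sum_(i < n) \sum_(j < n) (z i ^+ 2 + z j ^+ 2) / 2)).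
  apply: ler_sum => i _; apply: ler_sum => j _.
  have /andP[g0 g1] := geo_le1 i j r01.
  apply: (@le_trans _ _ (`|z i * z j| * 1)).
    apply: (@le_trans _ _ (`|z i * z j| * geo i j)); first by rewrite ler_wpM2r// ler_norm.
    by rewrite ler_wpM2l.
  move: (z i) (z j) => a b.
  rewrite mulr1 ler_norml; have := sqr_ge0 (a + b); have := sqr_ge0 (a - b).
  by move=> *; apply/andP; split; nra.
under eq_bigr do rewrite -mulr_suml big_split/= sumr_const card_ord.
rewrite -mulr_suml big_split/= sumr_const card_ord sumrMnl.
by rewrite mulr_natl; move: (_ *+ n) => t; lra.
Qed.

End geometric_kernel.

Section covariance.
Variables (R : realType).

(** Correlation of the exponential part between neighbouring sites, which are [1/n] apart. *)
Definition decay (n : nat) (kappa : R) : R := expR (- kappa / n%:R).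

Lemma decay_bounds n kappa : 0 < kappa -> 0 <= decay n kappa <= 1.
Proof.
move=> k0; rewrite expR_ge0 /= -expR0 ler_expR mulNr oppr_le0.
by rewrite divr_ge0// ltW.
Qed.

Lemma covmxE n v2 s2 kappa (i j : 'I_n) :
  covmx n (v2, s2, kappa) i j = s2 * geo (decay n kappa) i j + v2 *+ (i == j).
Proof.
rewrite /covmx !mxE; congr (_ * _ + _).
rewrite /geo /decay -expRM_natl; congr expR.
have n0 : (n%:R : R) != 0 by rewrite pnatr_eq0 -lt0n (leq_ltn_trans _ (ltn_ord i)).
have -> : `|site R i - site R j| = ((i - j) + (j - i))%N%:R / n%:R.
  rewrite /site -mulrBl normrM (@ger0_norm _ n%:R^-1) ?invr_ge0//; congr (_ / _).
  case: (leqP i j) => ij.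
    rewrite distrC ger0_norm ?subr_ge0 ?ler_nat//.
    by rewrite -natrB// subSS (eqP (_ : (i - j)%N == 0)) ?subn_eq0//.
  rewrite ger0_norm ?subr_ge0 ?ler_nat//; last by rewrite ltnW.
  rewrite -natrB ?ltnS ?(ltnW ij)// subSS (eqP (_ : (j - i)%N == 0)) ?addn0//.
  by rewrite subn_eq0 ltnW.
by field.
Qed.

End covariance.

Section covariance_posdef.
Variables (R : realType) (n : nat).

(** Extension by 0 to all natural indices, so that difference operators can refer to neighbours
    without bound proofs. *)
Definition ext (z : 'cV[R]_n) (k : nat) : R := oapp (fun i => z i 0) 0 (insub k).

Lemma extE z (i : 'I_n) : ext z i = z i 0.
Proof. by rewrite /ext valK. Qed.

Lemma qformE (M : 'M[R]_n) z : qform M z = \sum_i \sum_j z i 0 * z j 0 * M i j.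
Proof.
rewrite /qform mxE exchange_big /=; apply: eq_bigr => j _.
rewrite mxE mulr_suml; apply: eq_bigr => i _; rewrite mxE; ring.
Qed.

Variables (v2 s2 kappa : R).
Hypotheses (v2_gt0 : 0 < v2) (s2_gt0 : 0 < s2) (kappa_gt0 : 0 < kappa).
Local Notation Sigma := (covmx n (v2, s2, kappa)).

Lemma covmx_sym : Sigma^T = Sigma.
Proof. by apply/matrixP => i j; rewrite mxE !covmxE geoC eq_sym. Qed.

Lemma qform_covmx z : qform Sigma z =
  s2 * (\sum_(i < n) \sum_(j < n) ext z i * ext z j * geo (decay n kappa) i j)
  + v2 * \sum_i z i 0 ^+ 2.
Proof.
rewrite qformE !mulr_sumr -big_split; apply: eq_bigr => i _ /=.
rewrite mulr_sumr (bigD1 i)//= [in RHS](bigD1 i)//= !covmxE eqxx mulr1n.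
under eq_bigr => j ji do rewrite covmxE eq_sym (negbTE ji) mulr0n addr0.
under [in RHS]eq_bigr do rewrite !extE.
rewrite !extE; set a := geo _ _ _.
have -> : \sum_(j < n | j != i) z i 0 * z j 0 * (s2 * geo (decay n kappa) i j) =
  \sum_(j < n | j != i) s2 * (z i 0 * z j 0 * geo (decay n kappa) i j).
  by apply: eq_bigr => j _; ring.
by ring.
Qed.

Lemma covmx_posdef : posdef Sigma.
Proof.
split; first exact: covmx_sym.
move=> z z0; rewrite qform_covmx ltr_wpDl//.
  by rewrite mulr_ge0 ?(ltW s2_gt0)// geo_psd// decay_bounds.
rewrite mulr_gt0// lt0r sumr_ge0 ?andbT => [|i _]; last exact: sqr_ge0.
apply: contra_neq z0 => /eqP; rewrite psumr_eq0 => [|i _]; last exact: sqr_ge0.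
move=> /allP H; apply/matrixP => i j; rewrite ord1 mxE.
by have := H i (mem_index_enum i); rewrite /= sqrf_eq0 => /eqP.
Qed.

Lemma qform_covmx_le z : qform Sigma z <= (s2 * n%:R + v2) * \sum_i z i 0 ^+ 2.
Proof.
rewrite qform_covmx mulrDl lerD2r -mulrA ler_wpM2l ?(ltW s2_gt0)//.
rewrite (le_trans (geo_sum_le _ _ (decay_bounds n kappa_gt0)))//.
by under eq_bigr do rewrite extE.
Qed.

(** With [w = Sigma^-1 f] and [c = s2 n + v2], the nonnegative number [qform Sigma (w - f/c)] equals
    [f' Sigma^-1 f - 2 |f|^2 / c + f' Sigma f / c^2], whose last term is at most [|f|^2 / c]. *)
Lemma qform_invmx_covmx_ge (f : 'cV[R]_n) :
  \sum_i f i 0 ^+ 2 / (s2 * n%:R + v2) <= qform (invmx Sigma) f.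
Proof.
have uS := posdef_unitmx covmx_posdef.
have c0 : 0 < s2 * n%:R + v2 by rewrite ltr_wpDl// mulr_ge0 ?(ltW s2_gt0)// ler0n.
set c := s2 * _ + _ in c0 *; set S := \sum_i f i 0 ^+ 2.
pose w := invmx Sigma *m f.
have := posdef_ge0 (w - c^-1 *: f) covmx_posdef.
rewrite qformB ?covmx_sym//.
have -> : qform Sigma w = qform (invmx Sigma) f.
  rewrite /qform /w trmx_mul trmx_inv covmx_sym -!mulmxA mulKVmx//.
have -> : ((c^-1 *: f)^T *m Sigma *m w) 0 0 = c^-1 * S.
  rewrite /w -mulmxA mulKVmx// [(_ *: f)^T]linearZ/= -scalemxAl mxE; congr (_ * _).
  by rewrite mxE; apply: eq_bigr => i _; rewrite mxE expr2.
have -> : qform Sigma (c^-1 *: f) = c^-1 ^+ 2 * qform Sigma f.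
  by rewrite /qform [(_ *: f)^T]linearZ/= -!scalemxAl -scalemxAr !mxE expr2 mulrA.
have := qform_covmx_le f; rewrite -/c -/S => qf H.
rewrite -mulr_suml -/S mulrC.
have : c^-1 ^+ 2 * qform Sigma f <= c^-1 * S.
  rewrite expr2 -mulrA ler_pM2l ?invr_gt0// mulrC ler_pdivrMr// mulrC; exact: qf.
by lra.
Qed.

End covariance_posdef.

Ltac nat_lia :=
  repeat match goal with
  | H : context [@Order.le] |- _ => clear H
  | H : context [@Order.lt] |- _ => clear H
  | H : @eq (Real.sort _) _ _ |- _ => clear H
  end; lia.

(** * The tridiagonal operator and its maximum principle *)

Section stencil.
Variables (R : realType) (n : nat) (rho : R).
Hypothesis n_ge2 : (1 < n)%N.

(* Up to the factor [1 - rho ^+ 2], the tridiagonal inverse of [geo rho]. *)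
Definition stencil (y : nat -> R) (i : nat) : R :=
  if i == 0%N then y 0%N - rho * y 1%N
  else if i.+1 == n then y i - rho * y i.-1
  else (1 + rho ^+ 2) * y i - rho * (y i.-1 + y i.+1).

Lemma eq_stencil (y z : nat -> R) i : (i < n)%N ->
  (forall k, (k < n)%N -> y k = z k) -> stencil y i = stencil z i.
Proof.
move=> ilt yz; rewrite /stencil; case: eqP => [_|/eqP i0].
  by rewrite !yz//; lia.
by case: eqP => [_|/eqP iN]; rewrite !yz//; lia.
Qed.

Lemma stencil_sum (c : 'I_n -> R) (y : 'I_n -> nat -> R) i :
  stencil (fun k => \sum_j c j * y j k) i = \sum_j c j * stencil (y j) i.
Proof.
rewrite /stencil; case: ifP => _; last case: ifP => _.
- by rewrite mulr_sumr -sumrB; apply: eq_bigr => j _; ring.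
- by rewrite mulr_sumr -sumrB; apply: eq_bigr => j _; ring.
- by rewrite -big_split/= !mulr_sumr -sumrB; apply: eq_bigr => j _; ring.
Qed.

Lemma stencil_lin (a b : R) (y z : nat -> R) i :
  stencil (fun k => a * y k + b * z k) i = a * stencil y i + b * stencil z i.
Proof. by rewrite /stencil; case: ifP => _; last case: ifP => _; ring. Qed.

(** Away from the diagonal, powers of [rho] solve [(1 + rho^2) y_k = rho (y_(k-1) + y_(k+1))], and
    the two end rows annihilate them as well. *)
Lemma stencil_geo i j : (i < n)%N -> (j < n)%N ->
  stencil (fun k => geo rho k j) i = (1 - rho ^+ 2) *+ (i == j).
Proof.
move=> ilt jlt; rewrite /stencil /geo.
case: (ltngtP i j) => [ij|ji|<-{j jlt}].
- have [k ->] : exists k, j = (i + k).+1 by exists (j - i.+1)%N; lia.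
  rewrite mulr0n.
  case: eqP => [->|/eqP i0].
    rewrite (_ : (0 - (0 + k).+1 + ((0 + k).+1 - 0) = k.+1)%N); last lia.
    rewrite (_ : (1 - (0 + k).+1 + ((0 + k).+1 - 1) = k)%N); last lia.
    by rewrite exprS subrr.
  rewrite ifF; last by apply/negbTE/eqP; lia.
  rewrite (_ : (i - (i + k).+1 + ((i + k).+1 - i) = k.+1)%N); last lia.
  rewrite (_ : (i.-1 - (i + k).+1 + ((i + k).+1 - i.-1) = k.+2)%N); last lia.
  rewrite (_ : (i.+1 - (i + k).+1 + ((i + k).+1 - i.+1) = k)%N); last lia.
  by rewrite !exprS; ring.
- have [k ->] : exists k, i = (j + k).+1 by exists (i - j.+1)%N; lia.
  rewrite mulr0n /=.
  case: eqP => [iN|/eqP iN].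
    rewrite (_ : ((j + k).+1 - j + (j - (j + k).+1) = k.+1)%N); last lia.
    rewrite (_ : (j + k - j + (j - (j + k)) = k)%N); last lia.
    by rewrite exprS subrr.
  rewrite (_ : ((j + k).+1 - j + (j - (j + k).+1) = k.+1)%N); last lia.
  rewrite (_ : (j + k - j + (j - (j + k)) = k)%N); last lia.
  rewrite (_ : ((j + k).+2 - j + (j - (j + k).+2) = k.+2)%N); last lia.
  by rewrite !exprS; ring.
- rewrite mulr1n; case: eqP => [->|/eqP i0]; first by rewrite !subnn !sub0n subn0 expr0; ring.
  rewrite subnn addn0 expr0.
  rewrite (_ : (i.-1 - i + (i - i.-1) = 1)%N); last lia.
  rewrite (_ : (i.+1 - i + (i - i.+1) = 1)%N); last lia.
  by case: eqP => _; ring.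
Qed.

Hypothesis rho01 : 0 <= rho <= 1.

(* Maximum principle: at a negative minimum the stencil would be nonpositive. *)
Lemma stencil_nonneg (a b : R) (u : nat -> R) : 0 < a -> 0 <= b ->
  (forall i, (i < n)%N -> 0 <= a * u i + b * stencil u i) ->
  forall i, (i < n)%N -> 0 <= u i.
Proof.
move=> a0 b0 H i ilt; have n0 : (0 < n)%N by lia.
have /andP[r0 r1] := rho01.
case: (@Order.TotalTheory.arg_minP _ R _ (Ordinal ilt) xpredT (fun k : 'I_n => u k)) => //= k _ kmin.
have km j : (j < n)%N -> u k <= u j by move=> jlt; exact: (kmin (Ordinal jlt)).
suff uk : 0 <= u k by rewrite (le_trans uk)// km.
rewrite leNgt; apply/negP => uk.
have := H k (ltn_ord k); rewrite leNgt => /negP; apply.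
suff : stencil u k <= 0.
  move=> s0; rewrite -[ltRHS]addr0 ltr_leD// ?mulr_ge0_le0//.
  by rewrite pmulr_rlt0.
have kn := ltn_ord k.
have rk j : (j < n)%N -> rho * u k <= rho * u j by move=> /km; exact: ler_wpM2l.
have d0 : (1 - rho) * u k <= 0 by rewrite mulr_ge0_le0 ?subr_ge0// ltW.
rewrite /stencil; case: eqP => [k0|/eqP k0].
  by have := rk 1%N n_ge2; rewrite k0 in d0 *; lra.
have := rk k.-1 (leq_ltn_trans (leq_pred _) kn) => u1.
case: eqP => [kN|/eqP kN]; first by lra.
have {rk} : rho * u k <= rho * u k.+1 by apply: rk; lia.
have : (1 - rho) ^+ 2 * u k <= 0 by rewrite mulr_ge0_le0 ?sqr_ge0// ltW.
by nra.
Qed.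

(** Nonnegativity is applied to [W + w] and [W - w]: a supersolution [W] dominates the solution
    [w]. *)
Lemma stencil_compare (a b : R) (w W g : nat -> R) : 0 < a -> 0 <= b ->
  (forall i, (i < n)%N -> a * w i + b * stencil w i = g i) ->
  (forall i, (i < n)%N -> `|g i| <= a * W i + b * stencil W i) ->
  forall i, (i < n)%N -> `|w i| <= W i.
Proof.
move=> a0 b0 wg gW i ilt; rewrite ler_norml.
have H (e : R) : e = 1 \/ e = -1 -> 0 <= 1 * W i + e * w i.
  move=> e1; apply: (@stencil_nonneg a b (fun k => 1 * W k + e * w k)) => // k klt.
  rewrite stencil_lin; have := gW k klt; rewrite -wg// ler_norml => /andP[].
  by case: e1 => ->; lra.
have := H 1 (or_introl erefl); have := H (-1) (or_intror erefl).
by move=> *; apply/andP; split; lra.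
Qed.

End stencil.

(** The stencil turns the exponential part of [f = Sigma w] into a multiple of [w], so [w] solves a
    tridiagonal system to which the maximum principle applies. *)
Lemma stencil_covmx (R : realType) (n : nat) (v2 s2 kappa : R) (f : 'cV[R]_n) (i : nat) :
  (1 < n)%N -> 0 < v2 -> 0 < s2 -> 0 < kappa -> (i < n)%N ->
  let rho := decay n kappa in
  let w := invmx (covmx n (v2, s2, kappa)) *m f in
  s2 * (1 - rho ^+ 2) * ext w i + v2 * stencil n rho (ext w) i = stencil n rho (ext f) i.
Proof.
move=> n2 v0 s0 k0 ilt rho w.
have uS := posdef_unitmx (covmx_posdef n v0 s0 k0).
have fE k : (k < n)%N -> ext f k = s2 * (\sum_(j < n) ext w j * geo rho k j) + v2 * ext w k.
  move=> klt; rewrite -[k]/(nat_of_ord (Ordinal klt)) !extE.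
  have -> : f = covmx n (v2, s2, kappa) *m w by rewrite /w mulKVmx.
  rewrite mxE mulr_sumr (bigD1 (Ordinal klt))// [in RHS](bigD1 (Ordinal klt))//.
  rewrite covmxE eqxx mulr1n !extE.
  under eq_bigr => j ji do rewrite covmxE eq_sym (negbTE ji) mulr0n addr0.
  under [in RHS]eq_bigr do rewrite extE.
  set S1 := \sum_(i | _) _; set S2 := \sum_(i | _) _.
  have -> : S1 = S2 by apply: eq_bigr => j _; rewrite -/rho; ring.
  by rewrite -/rho /=; ring.
rewrite (eq_stencil rho n2 ilt fE) stencil_lin; congr (_ + _).
rewrite -mulrA; congr (_ * _).
rewrite (stencil_sum rho (fun j : 'I_n => ext w j) (fun j k => geo rho k j)).
rewrite (bigD1 (Ordinal ilt))//= stencil_geo// eqxx mulr1n big1 ?addr0 => [|j ji].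
  by rewrite mulrC.
rewrite stencil_geo// -val_eqE eq_sym /= in ji *.
by rewrite (negbTE ji) mulr0n mulr0.
Qed.

(** * Uniform bounds on the inverse covariance *)

Section powers.
Variable R : realType.

Lemma powerB_le (x y : R) (j : nat) : 0 <= x <= 1 -> 0 <= y <= 1 ->
  `|x ^+ j - y ^+ j| <= j%:R * `|x - y|.
Proof.
move=> /andP[x0 x1] /andP[y0 y1]; elim: j => [|j IH]; first by rewrite !expr0 subrr normr0 mul0r.
have -> : x ^+ j.+1 - y ^+ j.+1 = x * (x ^+ j - y ^+ j) + y ^+ j * (x - y).
  by rewrite !exprS; ring.
rewrite (le_trans (ler_normD _ _))// -natr1 mulrDl mul1r !normrM lerD//.
  by rewrite (le_trans _ IH)// ler_piMl// ger0_norm.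
by rewrite ler_piMl// ger0_norm ?exprn_ge0// exprn_ile1.
Qed.

(** The induction writes the next second difference as [x] times the previous one plus [h] times a
    first difference. *)
Lemma power_diff2_le (x h : R) (j : nat) : 0 <= h -> 0 <= x - h -> x + h <= 1 ->
  `|(x - h) ^+ j + (x + h) ^+ j - 2 * x ^+ j| <= j%:R ^+ 2 * h ^+ 2.
Proof.
move=> h0 xh0 xh1; elim: j => [|j IH].
  rewrite !expr0 (_ : 1 + 1 - 2 * 1 = 0); last by ring.
  by rewrite normr0 expr0n mul0r.
have -> : (x - h) ^+ j.+1 + (x + h) ^+ j.+1 - 2 * x ^+ j.+1 =
   x * ((x - h) ^+ j + (x + h) ^+ j - 2 * x ^+ j) + h * ((x + h) ^+ j - (x - h) ^+ j).
  by rewrite !exprS; ring.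
have xb : 0 <= x <= 1 by apply/andP; split; lra.
have H := @powerB_le (x + h) (x - h) j.
have {}H : `|(x + h) ^+ j - (x - h) ^+ j| <= j%:R * (2 * h).
  rewrite (le_trans (H _ _))//; try by apply/andP; split; lra.
  by rewrite (_ : x + h - (x - h) = 2 * h) ?ger0_norm ?mulr_ge0//; ring.
have H1 : `|x * ((x - h) ^+ j + (x + h) ^+ j - 2 * x ^+ j)| <= j%:R ^+ 2 * h ^+ 2.
  rewrite normrM (le_trans _ IH)// ler_piMl// ger0_norm; by case/andP: xb.
have H2 : `|h * ((x + h) ^+ j - (x - h) ^+ j)| <= h * (j%:R * (2 * h)).
  by rewrite normrM ger0_norm// ler_wpM2l.
rewrite (le_trans (ler_normD _ _))// (le_trans (lerD H1 H2))//.
have hh : 0 <= h ^+ 2 by exact: sqr_ge0.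
have -> : j.+1%:R ^+ 2 * h ^+ 2 = j%:R ^+ 2 * h ^+ 2 + h * (j%:R * (2 * h)) + h ^+ 2.
  by rewrite -natr1; ring.
by rewrite lerDl.
Qed.

Lemma bernoulli_le (x : R) (m : nat) : 0 <= x <= 1 -> (1 - x) ^+ m * (1 + m%:R * x) <= 1.
Proof.
move=> /andP[x0 x1]; elim: m => [|m IH]; first by rewrite expr0 mul0r addr0 mulr1.
apply: le_trans IH; rewrite exprSr -mulrA ler_wpM2l ?exprn_ge0 ?subr_ge0//.
have m0 : 0 <= m%:R :> R by [].
by rewrite -natr1; move: (m%:R) m0 => k k0; nra.
Qed.

Lemma geometric_sum_le (r : R) (n : nat) : 0 <= r -> (1 - r) * \sum_(i < n) r ^+ i <= 1.
Proof.
by move=> r0; rewrite -opprB mulNr -subrX1 opprB gerBl exprn_ge0.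
Qed.

End powers.

Section decay.
Variables (R : realType) (n : nat) (kappa : R).
Hypotheses (n_gt0 : (0 < n)%N) (kappa_gt0 : 0 < kappa).
Local Notation rho := (decay n kappa).

Lemma decay_ge : 1 - rho <= kappa / n%:R.
Proof. by have := expR_ge1Dx (- kappa / n%:R); rewrite -/(decay _ _); lra. Qed.

Lemma decay_le : rho * (kappa / n%:R) <= 1 - rho.
Proof.
have : rho * (1 + kappa / n%:R) <= 1.
  have E : rho * expR (kappa / n%:R) = 1.
    by rewrite -expRD mulNr addNr expR0.
  by rewrite -[leRHS]E; apply: ler_wpM2l; [exact: expR_ge0|exact: expR_ge1Dx].
by lra.
Qed.

Lemma decay_lt1 : rho < 1.
Proof. by rewrite -expR0 ltr_expR mulNr oppr_lt0 divr_gt0// ltr0n. Qed.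

End decay.

Section stencil_power.
Variables (R : realType) (n : nat) (kappa : R) (j : nat).
Hypotheses (n_ge2 : (1 < n)%N) (kappa_gt0 : 0 < kappa).
Local Notation rho := (decay n kappa).

Definition power_site (k : nat) : R := (k.+1%:R / n%:R) ^+ j.

Let n0 : (0 : R) < n%:R. Proof. by rewrite ltr0n; nat_lia. Qed.

(** The end rows are one-sided differences, hence only of order [1/n]; the boundary layers of the
    envelope exist to absorb them. *)
Lemma stencil_power_end i : (i < n)%N -> (i == 0%N) || (i.+1 == n) ->
  `|stencil n rho power_site i| <= (j%:R + kappa) / n%:R.
Proof.
move=> ilt iend.
have site01 k : (k < n)%N -> 0 <= (k.+1%:R / n%:R : R) <= 1.
  by move=> kn; rewrite divr_ge0//= ler_pdivrMr// mul1r ler_nat.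
have H k l : (k < n)%N -> (l < n)%N -> `|k.+1%:R - l.+1%:R| <= 1 :> R ->
    `|power_site k - rho * power_site l| <= (j%:R + kappa) / n%:R.
  move=> kn ln kl.
  have -> : power_site k - rho * power_site l =
    (power_site k - power_site l) + (1 - rho) * power_site l by ring.
  rewrite (le_trans (ler_normD _ _))// [leRHS]mulrDl lerD//.
    rewrite (le_trans (powerB_le _ (site01 _ kn) (site01 _ ln)))// ler_wpM2l//.
    by rewrite -mulrBl normrM [`|n%:R^-1|]ger0_norm ?invr_ge0 ?(ltW n0)// ler_piMl// invr_ge0 (ltW n0).
  have /andP[r0 r1] := decay_bounds n kappa_gt0.
  rewrite normrM ger0_norm ?subr_ge0// (le_trans _ (decay_ge n kappa))//.
  have /andP[l0 l1] := site01 _ ln.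
  by rewrite ler_piMr ?subr_ge0// ger0_norm ?exprn_ge0// exprn_ile1.
rewrite /stencil; case: eqP => [i0|/eqP i0].
  apply: H => //; first by nat_lia.
  by rewrite -[2%:R]natr1 opprD addNKr normrN1.
rewrite (negbTE i0) /= in iend; rewrite iend; apply: H => //; first by nat_lia.
have -> : i.-1.+1 = i by nat_lia.
by rewrite -natr1 ler_norml; apply/andP; split; lra.
Qed.

(** The stencil is [(1 - rho)^2 x^j] minus [rho] times a second difference, of order [1/n^2]. A
    factor [1 - rho] is kept apart because it also divides the coefficient [s2 (1 - rho^2)] against
    which this is compared. *)
Lemma stencil_power_int i : (i < n)%N -> ~~ ((i == 0%N) || (i.+1 == n)) ->
  `|stencil n rho power_site i| <= (1 - rho) * ((kappa + j%:R ^+ 2 / kappa) / n%:R).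
Proof.
move=> ilt; rewrite negb_or => /andP[i0 iN].
rewrite /stencil (negbTE i0) (negbTE iN).
have /andP[r0 r1] := decay_bounds n kappa_gt0.
pose h : R := n%:R^-1; pose x : R := i.+1%:R / n%:R.
have h0 : 0 < h by rewrite invr_gt0.
have e1 : power_site i.-1 = (x - h) ^+ j.
  rewrite /power_site /x /h; congr (_ ^+ _).
  rewrite (_ : i.-1.+1 = i); last by nat_lia.
  by rewrite -natr1 mulrDl mul1r addrK.
have e2 : power_site i.+1 = (x + h) ^+ j.
  by rewrite /power_site /x /h -[i.+2%:R]natr1 mulrDl mul1r.
have x0 : 0 <= x - h by rewrite /x /h -natr1 mulrDl mul1r addrK divr_ge0.
have x1 : x + h <= 1.
  by rewrite /x /h -[X in _ + X]mul1r -mulrDl natr1 ler_pdivrMr// mul1r ler_nat; nat_lia.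
have := power_diff2_le j (ltW h0) x0 x1.
rewrite e1 e2 -/(power_site i) /power_site -/x; set q2 := (_ + _ - _) => q2le.
have -> : (1 + rho ^+ 2) * x ^+ j - rho * ((x - h) ^+ j + (x + h) ^+ j) =
  (1 - rho) ^+ 2 * x ^+ j - rho * q2 by rewrite /q2; ring.
have xj : `|x ^+ j| <= 1.
  by rewrite ger0_norm ?exprn_ge0 ?exprn_ile1//; lra.
have d1 := decay_ge n kappa; have d2 := decay_le n kappa.
rewrite (le_trans (ler_normB _ _))// normrM [X in _ + X]normrM (@ger0_norm _ ((1 - rho) ^+ 2)) ?sqr_ge0//.
rewrite (@ger0_norm _ rho)// [(_ + _) / n%:R]mulrDl [leRHS]mulrDr lerD//.
  rewrite expr2 -mulrA ler_wpM2l ?subr_ge0// (le_trans _ d1)//.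
  by rewrite ler_piMr// subr_ge0.
apply: (@le_trans _ _ (rho * (j%:R ^+ 2 * h ^+ 2))); first by rewrite ler_wpM2l.
have -> : rho * (j%:R ^+ 2 * h ^+ 2) = (rho * (kappa / n%:R)) * (j%:R ^+ 2 / kappa / n%:R).
  by rewrite /h; field; rewrite !gt_eqF.
by rewrite ler_wpM2r// !divr_ge0 ?sqr_ge0// ltW.
Qed.

End stencil_power.

(* The two boundary layers of width [sqrt n]. *)
Definition layers (R : realType) (n : nat) (r : R) (k : nat) : R := r ^+ k + r ^+ (n.-1 - k).

(** Supersolution for [stencil_compare]. The layers fall off at rate [c / sqrt n] per site, which
    keeps their sum bounded. *)
Definition envelope (R : realType) (n : nat) (c D : R) (k : nat) : R :=
  D * (layers n (1 - c / Num.sqrt n%:R) k / Num.sqrt n%:R + n%:R^-1).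

Section layers.
Variables (R : realType) (n : nat) (rho r : R).
Hypotheses (n_ge2 : (1 < n)%N) (rho01 : 0 <= rho <= 1) (r_bounds : 2^-1 <= r <= 1).

Lemma layers_ge0 k : 0 <= layers n r k.
Proof. by case/andP: r_bounds => r0 r1; rewrite addr_ge0// exprn_ge0//; lra. Qed.

(** The only negative part of the stencil is [- rho (1 - r)^2 (r^a + r^b)], and [r^a <= 2 r^(a+1)]
    because [r >= 1/2]. *)
Lemma stencil_layers_int i : (0 < i)%N -> (i.+1 < n)%N ->
  - (2 * rho * (1 - r) ^+ 2) * layers n r i <= stencil n rho (layers n r) i.
Proof.
move=> i0 iN; rewrite /stencil ifF; last by apply/negbTE; nat_lia.
rewrite ifF; last by apply/negbTE; nat_lia.
have /andP[q0 q1] := rho01; have /andP[r0 r1] := r_bounds.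
have [a ia] : exists a, i = a.+1 by exists i.-1; nat_lia.
have [b nb] : exists b, (n.-1 = i + b.+1)%N by exists (n.-1 - i).-1; nat_lia.
rewrite /layers nb ia /=.
rewrite (_ : a.+1 + b.+1 - a.+1 = b.+1)%N; last nat_lia.
rewrite (_ : a.+1 + b.+1 - a = b.+2)%N; last nat_lia.
rewrite (_ : a.+1 + b.+1 - a.+2 = b)%N; last nat_lia.
rewrite -subr_ge0; set X := (X in 0 <= X).
have -> : X = (1 - rho) ^+ 2 * (r ^+ a.+1 + r ^+ b.+1) +
    rho * (1 - r) ^+ 2 * ((2 * r - 1) * (r ^+ a + r ^+ b)).
  by rewrite /X !exprS; ring.
have p k : 0 <= r ^+ k by rewrite exprn_ge0//; lra.
rewrite addr_ge0//; first by rewrite mulr_ge0 ?sqr_ge0 ?addr_ge0.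
have r12 : 0 <= 2 * r - 1 by lra.
by rewrite mulr_ge0 ?(mulr_ge0 q0) ?(mulr_ge0 r12) ?sqr_ge0 ?addr_ge0 ?p.
Qed.

(** The drop is [(1 - r) (1 - r^(n-2))]: the layer coming from the far end takes away at most half
    of it. *)
Lemma layers_first_diff : r ^+ n.-2 <= 2^-1 ->
  (1 - r) / 2 <= layers n r 0 - layers n r 1.
Proof.
move=> rn; have /andP[r0 r1] := r_bounds.
rewrite /layers subn0 subn1 expr0 expr1.
have -> : r ^+ n.-1 = r * r ^+ n.-2 by rewrite -exprS; congr (_ ^+ _); nat_lia.
move: (r ^+ n.-2) rn => y yle.
have -> : 1 + r * y - (r + y) = (1 - r) * (1 - y) by ring.
by rewrite ler_wpM2l; lra.
Qed.

Lemma layersC k : (k < n)%N -> layers n r (n.-1 - k) = layers n r k.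
Proof. by move=> kn; rewrite /layers addrC; congr (r ^+ _ + _); nat_lia. Qed.

Lemma sum_layers_le : (1 - r) * \sum_(k < n) layers n r k <= 2.
Proof.
have r0 : 0 <= r by case/andP: r_bounds; lra.
rewrite big_split /= mulrDr.
have H := geometric_sum_le n r0.
rewrite [X in _ + _ * X](reindex_inj rev_ord_inj) /=.
under [X in _ + _ * X]eq_bigr => k _.
  have -> : (n.-1 - (n - k.+1) = k)%N by have := ltn_ord k; nat_lia.
  over.
by lra.
Qed.

End layers.

Section envelope.
Variables (R : realType) (lo hi c D : R) (q : nat).
Hypotheses (lo_gt0 : 0 < lo) (lo_le1 : lo <= 1) (hi_ge1 : 1 <= hi).

(** [c] is small enough for the zeroth-order term to outweigh the negative stencil of the layers.
    The first summand of [D] serves the interior rows, the second the end rows. *)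
Hypotheses (cE : c = lo / (2 * hi))
  (DE : D = (hi + q%:R ^+ 2 / lo) / lo + 2 * (q%:R + hi) / (lo * c)).

Let bounds : [/\ 0 < lo, lo <= 1 & 1 <= hi]. Proof. by []. Qed.

Let hi_gt0 : 0 < hi. Proof. exact: lt_le_trans hi_ge1. Qed.
Let c_gt0 : 0 < c. Proof. by rewrite cE divr_gt0// mulr_gt0. Qed.
Let c_le : c <= 2^-1.
Proof. by have [? ? ?] := bounds; rewrite cE ler_pdivrMr ?mulr_gt0// mulKf ?pnatr_eq0//; lra. Qed.
Let D1_ge0 : 0 <= (hi + q%:R ^+ 2 / lo) / lo.
Proof. by rewrite divr_ge0 ?(ltW lo_gt0)// addr_ge0 ?divr_ge0 ?sqr_ge0 ?(ltW lo_gt0) ?(ltW hi_gt0). Qed.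
Let D2_ge0 : 0 <= 2 * (q%:R + hi) / (lo * c).
Proof. by rewrite divr_ge0// ?mulr_ge0 ?addr_ge0 ?(ltW lo_gt0) ?(ltW c_gt0) ?(ltW hi_gt0). Qed.
Let D_ge0 : 0 <= D. Proof. by rewrite DE addr_ge0. Qed.

Section fixed_n.
Variable n : nat.
Hypotheses (n_ge4 : (3 < n)%N) (n_large : 4 / c ^+ 2 <= n%:R).
Local Notation s := (Num.sqrt (n%:R : R)).
Local Notation r := (1 - c / s).

Let n_gt0 : (0 : R) < n%:R. Proof. by rewrite ltr0n; nat_lia. Qed.
Let s_gt0 : 0 < s. Proof. by rewrite sqrtr_gt0. Qed.
Let s_ge1 : 1 <= s. Proof. by rewrite -[leLHS]sqrtr1 ler_sqrt ?ler1n ?ler0n//; nat_lia. Qed.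
Let ss : s * s = n%:R. Proof. by rewrite -expr2 sqr_sqrtr// ltW. Qed.
Let cs : 0 < c / s <= 2^-1.
Proof.
by rewrite divr_gt0//= ler_pdivrMr// (le_trans c_le)// -[leLHS]mulr1 ler_wpM2l.
Qed.
Let r_bounds : 2^-1 <= r <= 1. Proof. by case/andP: cs => *; apply/andP; split; lra. Qed.

(** As [n >= 4 / c^2], the product [(n - 2) c / sqrt n] is at least 1, and [bernoulli_le] gives one
    half. *)
Let r_pow : r ^+ n.-2 <= 2^-1.
Proof.
have /andP[c0 c1] := cs.
have c01 : 0 <= c / s <= 1 by apply/andP; split; lra.
have := bernoulli_le n.-2 c01; set y := _ ^+ _ => H.
have y0 : 0 <= y by rewrite exprn_ge0//; lra.
have : 1 <= n.-2%:R * (c / s).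
  have : n%:R / 2 <= n.-2%:R :> R.
    by rewrite ler_pdivrMr// -natrM ler_nat; nat_lia.
  have c2 : 2 <= c * s.
    rewrite -(@ler_pXn2r _ 2)//; last 2 first.
    - by rewrite nnegrE.
    - by rewrite nnegrE mulr_ge0 ?ltW.
    rewrite exprMn expr2 [s ^+ 2]expr2 ss -ler_pdivrMl ?exprn_gt0//.
    by rewrite mulrC (le_trans _ n_large)// -natrM.
  move=> n2; apply: (@le_trans _ _ (n%:R / 2 * (c / s))); last by rewrite ler_wpM2r// ltW.
  have -> : n%:R / 2 * (c / s) = c * s / 2 by rewrite -[X in X / 2 * _]ss; field; rewrite gt_eqF.
  by lra.
by move=> n2; nra.
Qed.

Lemma envelope_ge0 k : 0 <= envelope n c D k.
Proof.
rewrite mulr_ge0// addr_ge0 ?invr_ge0 ?(ltW n_gt0)//.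
by rewrite divr_ge0 ?(ltW s_gt0)//; exact: layers_ge0.
Qed.

Lemma sum_envelope_le : \sum_(k < n) envelope n c D k <= D * (2 / c + 1).
Proof.
rewrite -mulr_sumr ler_wpM2l// big_split /= sumr_const card_ord -[n%:R^-1 *+ n]mulr_natr mulVf ?gt_eqF//.
rewrite lerD2r -mulr_suml ler_pdivlMr//.
have := sum_layers_le (ltnW (ltnW n_ge4)) r_bounds.
set S := \sum_(k < n) _; rewrite opprB addrCA subrr addr0 => H.
by have -> : S / s * c = c / s * S by ring.
Qed.

(** At the ends the drop of the layers pays for the order [1/n]; in the interior the bulk pays for
    the order [1/n^2] while the layers contribute a nonnegative amount. The envelope does not depend
    on the parameters in the box. *)
Lemma envelope_stencil (v2 s2 kappa : R) (i : nat) :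
  lo <= v2 <= hi -> lo <= s2 <= hi -> lo <= kappa <= hi -> (i < n)%N ->
  forall j, (j <= q)%N ->
  `|stencil n (decay n kappa) (power_site R n j) i| <=
  s2 * (1 - decay n kappa ^+ 2) * envelope n c D i +
  v2 * stencil n (decay n kappa) (envelope n c D) i.
Proof.
move=> /andP[v1 v2h] /andP[s1 s2h] /andP[k1 k2h] ilt j jq.
have [lo0 lo1 hi1] := bounds; have c0 := c_gt0.
have n_ge2 : (1 < n)%N by exact: leq_ltn_trans n_ge4.
have k0 : 0 < kappa by lra.
have rho01 := decay_bounds n k0; have /andP[q0 q1] := rho01.
have d1 := decay_ge n kappa; have d2 := decay_le n kappa.
set rho := decay n kappa in rho01 q0 q1 d1 d2 *.
have jq' : j%:R <= q%:R :> R by rewrite ler_nat.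
have j0 : 0 <= j%:R :> R by [].
have A0 : 0 <= s2 * (1 - rho ^+ 2).
  by rewrite mulr_ge0 ?subr_ge0 ?exprn_ile1//; lra.
case: (boolP ((i == 0%N) || (i.+1 == n))) => [iend|iint].
  apply: (le_trans (stencil_power_end j n_ge2 k0 ilt iend)).
  apply: (@le_trans _ _ (v2 * stencil n rho (envelope n c D) i)); last first.
    by rewrite lerDr mulr_ge0// envelope_ge0.
  (* The envelope is symmetric, so both end rows reduce to its first difference at 0. *)
  have st : envelope n c D 0 - envelope n c D 1 <= stencil n rho (envelope n c D) i.
    have e1 : rho * envelope n c D 1 <= envelope n c D 1.
      by rewrite ler_piMl// envelope_ge0.
    rewrite /stencil; case: eqP => [_|/eqP i0]; first by lra.
    rewrite (negbTE i0) /= in iend; rewrite iend.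
    have -> : envelope n c D i = envelope n c D 0.
      rewrite /envelope -(@layersC _ n _ n_ge2 0)//; last by nat_lia.
      by rewrite (_ : n.-1 - 0 = i)%N//; nat_lia.
    have -> : envelope n c D i.-1 = envelope n c D 1.
      rewrite /envelope -(@layersC _ n _ n_ge2 1)//.
      by rewrite (_ : n.-1 - 1 = i.-1)%N//; nat_lia.
    by lra.
  apply: (@le_trans _ _ (lo * (D * (c / n%:R) / 2))).
    have -> : lo * (D * (c / n%:R) / 2) = lo * c * D / 2 / n%:R by ring.
    rewrite ler_wpM2r ?invr_ge0 ?(ltW n_gt0)//.
    have : lo * c * (2 * (q%:R + hi) / (lo * c)) <= lo * c * D.
      by rewrite ler_wpM2l ?mulr_ge0 ?(ltW lo_gt0) ?(ltW c_gt0)// DE lerDr.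
    have -> : lo * c * (2 * (q%:R + hi) / (lo * c)) = 2 * (q%:R + hi).
      by field; rewrite !gt_eqF.
    by move: (lo * c * D) => t; lra.
  have ld := layers_first_diff n_ge2 r_bounds r_pow.
  have low : D * (c / n%:R) / 2 <= stencil n rho (envelope n c D) i.
    apply: le_trans st; rewrite /envelope -mulrBr -[leLHS]mulrA ler_wpM2l//.
    rewrite opprD addrACA subrr addr0 -mulrBl ler_pdivlMr//.
    apply: le_trans ld.
    have -> : c / n%:R / 2 * s = c / s / 2 by rewrite -[X in c / X / 2]ss; field; rewrite gt_eqF.
    by lra.
  apply: ler_pM => //; first by lra.
  by rewrite !mulr_ge0 ?invr_ge0 ?(ltW c_gt0) ?(ltW n_gt0)//.
apply: (le_trans (stencil_power_int j n_ge2 k0 ilt iint)).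
move: iint; rewrite negb_or => /andP[i0 iN].
have i_gt0 : (0 < i)%N by rewrite lt0n.
have iN1 : (i.+1 < n)%N by rewrite ltn_neqAle iN.
have sl := stencil_layers_int n_ge2 rho01 r_bounds i_gt0 iN1.
have {}sl : - (2 * rho * (c / s) ^+ 2) * layers n r i <= stencil n rho (layers n r) i.
  by move: sl; rewrite (_ : 1 - r = c / s)//; ring.
have eE : envelope n c D = (fun k => (D / s) * layers n r k + (D / n%:R) * 1).
  by apply/funext => k; rewrite /envelope; ring.
have s1E : stencil n rho (fun=> 1) i = (1 - rho) ^+ 2.
  by rewrite /stencil (negbTE i0) (negbTE iN); ring.
rewrite [X in stencil _ _ X]eE stencil_lin s1E eE.
set L := layers n r i in sl *; set SL := stencil n rho (layers n r) i in sl *.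
have L0 : 0 <= L by exact: layers_ge0.
have Ds : 0 <= D / s by rewrite divr_ge0// ltW.
have dd : 0 <= 1 - rho by lra.
(* The layers contribute a nonnegative amount: rho (c/s)^2 <= (1 - rho) c^2 / kappa. *)
have lay : 0 <= s2 * (1 - rho ^+ 2) * L + v2 * SL.
  have h1 : s2 * (1 - rho) * L <= s2 * (1 - rho ^+ 2) * L.
    rewrite ler_wpM2r// ler_wpM2l//; first by lra.
    by have := mulr_ge0 q0 dd; rewrite expr2; lra.
  have h2 : v2 * (- (2 * rho * (c / s) ^+ 2) * L) <= v2 * SL by rewrite ler_wpM2l//; lra.
  have h3 : v2 * (2 * rho * (c / s) ^+ 2) <= s2 * (1 - rho).
    have -> : v2 * (2 * rho * (c / s) ^+ 2) = (2 * v2 * c ^+ 2 / kappa) * (rho * (kappa / n%:R)).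
      by rewrite -[X in kappa / X]ss; field; rewrite !gt_eqF.
    have r3 : 0 <= rho * (kappa / n%:R) by rewrite mulr_ge0 ?divr_ge0 ?(ltW n_gt0) ?(ltW k0).
    apply: ler_pM => //.
    - by rewrite !mulr_ge0 ?invr_ge0 ?sqr_ge0 ?(ltW k0)//; lra.
    rewrite ler_pdivrMr// cE exprMn exprVn.
    apply: (@le_trans _ _ (2 * hi * (lo ^+ 2 / (2 * hi) ^+ 2))).
      by rewrite ler_wpM2r ?divr_ge0 ?sqr_ge0//; lra.
    have -> : 2 * hi * (lo ^+ 2 / (2 * hi) ^+ 2) = lo * (lo / (2 * hi)).
      by field; rewrite gt_eqF//; lra.
    have cl : lo / (2 * hi) <= lo.
      by rewrite ler_pdivrMr; [|lra]; rewrite ler_peMr//; lra.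
    by rewrite -cE in cl *; apply: ler_pM => //; lra.
  have := ler_wpM2r L0 h3; lra.
have key : (1 - rho) * ((kappa + j%:R ^+ 2 / kappa) / n%:R) <= s2 * (1 - rho ^+ 2) * (D / n%:R).
  have -> : s2 * (1 - rho ^+ 2) * (D / n%:R) = (1 - rho) * ((s2 * (1 + rho) * D) / n%:R) by ring.
  rewrite ler_wpM2l// ler_wpM2r ?invr_ge0 ?(ltW n_gt0)//.
  apply: (@le_trans _ _ (lo * D)); last first.
    rewrite ler_wpM2r//; apply: (@le_trans _ _ (s2 * 1)); first by lra.
    by rewrite ler_wpM2l//; lra.
  apply: (@le_trans _ _ (lo * ((hi + q%:R ^+ 2 / lo) / lo))); last first.
    by rewrite ler_wpM2l ?(ltW lo_gt0)// DE lerDl.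
  have -> : lo * ((hi + q%:R ^+ 2 / lo) / lo) = hi + q%:R ^+ 2 / lo by field; rewrite gt_eqF.
  rewrite lerD// ler_pM ?sqr_ge0 ?invr_ge0 ?(ltW k0)//.
    by rewrite ler_pXn2r ?nnegrE.
  by rewrite lef_pV2 ?posrE.
have h4 : 0 <= v2 * ((D / n%:R) * (1 - rho) ^+ 2).
  by rewrite !mulr_ge0 ?invr_ge0 ?sqr_ge0 ?(ltW n_gt0)//; lra.
have h5 := mulr_ge0 Ds lay.
apply: (le_trans key).
rewrite -subr_ge0; set X := (X in 0 <= X).
have -> : X = D / s * (s2 * (1 - rho ^+ 2) * L + v2 * SL) + v2 * ((D / n%:R) * (1 - rho) ^+ 2).
  by rewrite /X; ring.
exact: addr_ge0.
Qed.

End fixed_n.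
End envelope.

(** * Polynomial designs *)

Section polynomial_sums.
Variables (R : realType) (p : nat).

Definition peval (b : 'I_p.+1 -> R) (s : R) : R := \sum_j b j * s ^+ j.

Let node (k : 'I_p.+1) : R := k.+1%:R / p.+1%:R.

(** The Vandermonde matrix at [p + 1] distinct nodes is invertible, so the coefficients are
    controlled by the values at the nodes. *)
Lemma peval_nodes : exists K : R, 1 <= K /\
  forall b j, exists k : 'I_p.+1, `|b j| <= K * `|peval b (node k)|.
Proof.
pose V : 'M[R]_p.+1 := Vandermonde p.+1 (\row_k node k).
have uV : V \in unitmx.
  rewrite unitmxE unitfE det_Vandermonde; apply/prodf_neq0 => i _.
  apply/prodf_neq0 => j ij; rewrite !mxE subr_eq0 /node.
  apply/negP => /eqP/(mulIf _) => /(_ _)/eqP; rewrite invr_eq0 pnatr_eq0 => /(_ isT).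
  by rewrite eqr_nat eqSS => /eqP/val_inj ji; rewrite ji ltnn in ij.
pose K := 1 + \sum_k \sum_j `|invmx V k j|.
exists K; split; first by rewrite lerDl sumr_ge0// => k _; exact: sumr_ge0.
move=> b j.
case: (@Order.TotalTheory.arg_maxP _ R _ (ord0 : 'I_p.+1) xpredT (fun k => `|peval b (node k)|)) => //= k _ kmax.
exists k.
have bE : \row_j b j = (\row_k peval b (node k)) *m invmx V.
  rewrite -[LHS](mulmxK uV); congr (_ *m _); apply/rowP => l.
  by rewrite !mxE; apply: eq_bigr => i _; rewrite !mxE.
have -> : b j = \sum_i peval b (node i) * invmx V i j.
  have := congr1 (fun M : 'rV_p.+1 => M 0 j) bE; rewrite !mxE => ->.
  by apply: eq_bigr => i _; rewrite !mxE.
apply: (le_trans (ler_norm_sum _ _ _)).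
apply: (@le_trans _ _ (\sum_i `|peval b (node k)| * `|invmx V i j|)).
  by apply: ler_sum => i _; rewrite normrM ler_wpM2r//; exact: kmax.
rewrite -mulr_sumr mulrC ler_wpM2r// /K.
apply: (@le_trans _ _ (\sum_k0 \sum_j0 `|invmx V k0 j0|)); last by rewrite lerDr.
by apply: ler_sum => i _; rewrite (bigD1 j)//= lerDl sumr_ge0.
Qed.

Lemma peval_lipschitz b (M x y : R) : (forall j, `|b j| <= M) ->
  0 <= x <= 1 -> 0 <= y <= 1 ->
  `|peval b x - peval b y| <= M * p.+1%:R ^+ 2 * `|x - y|.
Proof.
move=> bM x01 y01; have M0 : 0 <= M by apply: le_trans (bM ord0).
rewrite /peval -sumrB (le_trans (ler_norm_sum _ _ _))//.
apply: (@le_trans _ _ (\sum_(j < p.+1) M * (p.+1%:R * `|x - y|))).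
  apply: ler_sum => j _; rewrite -mulrBr normrM ler_pM//.
  rewrite (le_trans (powerB_le _ x01 y01))// ler_wpM2r// ler_nat ltnW//.
rewrite sumr_const card_ord -[leLHS]mulr_natl.
by rewrite (_ : _ * (M * _) = M * p.+1%:R ^+ 2 * `|x - y|)//; ring.
Qed.

(** If [M] is the largest coefficient in absolute value, the polynomial is at least [M / K] at some
    node, hence at least [M / (2K)] on an interval of fixed length, which contains a fixed fraction
    of the sites. *)
Lemma sum_peval_ge : exists c : R, 0 < c /\ exists N : nat, forall n, (N <= n)%N ->
  forall b j, c * n%:R * b j ^+ 2 <= \sum_(i < n) peval b (site R i) ^+ 2.
Proof.
have [K [K1 HK]] := peval_nodes.
have q0 : 0 < p.+1%:R :> R by rewrite ltr0n.
have q1 : 1 <= p.+1%:R :> R by rewrite ler1n.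
(* Within this distance the Lipschitz constant [M (p+1)^2] allows a change of at most [M / (2K)]. *)
pose r0 : R := (2 * K * p.+1%:R ^+ 2)^-1.
have r0_gt0 : 0 < r0 by rewrite invr_gt0 !mulr_gt0// ?exprn_gt0//; lra.
have r0_le : r0 * p.+1%:R <= 2^-1.
  have -> : r0 * p.+1%:R = (2 * K * p.+1%:R)^-1.
    by rewrite /r0; field; rewrite !gt_eqF//; lra.
  rewrite lef_pV2 ?posrE ?mulr_gt0//; try lra.
  by rewrite -mulrA ler_peMr//; nra.
have c_gt0 : 0 < r0 / (16 * K ^+ 2).
  by rewrite divr_gt0// mulr_gt0// exprn_gt0//; lra.
exists (r0 / (16 * K ^+ 2)); split=> //.
exists (maxn (2 * p.+1) (Num.truncn (4 * p.+1%:R / r0)).+1) => n; rewrite geq_max => /andP[np nN] b.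
have nr0 : 4 * p.+1%:R <= r0 * n%:R.
  rewrite [leRHS]mulrC -ler_pdivrMr//; apply: (le_trans (ltW (truncnS_gt _))).
  by rewrite ler_nat.
have n0 : 0 < n%:R :> R by rewrite ltr0n; nat_lia.
case: (@Order.TotalTheory.arg_maxP _ R _ (ord0 : 'I_p.+1) xpredT (fun k => `|b k|)) => //= jm _ jmax.
pose M := `|b jm|.
have bM j : `|b j| <= M by exact: jmax.
suff main : r0 / (16 * K ^+ 2) * n%:R * M ^+ 2 <= \sum_(i < n) peval b (site R i) ^+ 2.
  move=> j; apply: le_trans main; rewrite ler_wpM2l//.
    by rewrite mulr_ge0 ?(ltW c_gt0) ?(ltW n0).
  by rewrite -[leLHS]real_normK ?num_real// ler_pXn2r ?nnegrE ?normr_ge0//; exact: bM.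
have [k kP] := HK b jm.
(* The site [Nk / n] lies below the node [(k+1)/(p+1)], at distance at most [(p+1)/n]. *)
pose m := (n %/ p.+1)%N.
pose Nk := (k.+1 * m)%N.
have kp := ltn_ord k.
have mn : (m * p.+1 <= n)%N by rewrite leq_trunc_div.
have nm : (n < m.+1 * p.+1)%N by rewrite -ltn_divLR.
have Nkn : (Nk <= n)%N by rewrite (leq_trans _ mn)// /Nk mulnC leq_mul2l kp orbT.
have [L [L1 L2]] : exists L : nat, L%:R <= r0 * n%:R / 2 /\ r0 * n%:R / 4 <= L%:R.
  exists (Num.truncn (r0 * n%:R / 2)); split.
    by rewrite truncn_le divr_ge0// mulr_ge0 ?(ltW r0_gt0) ?(ltW n0).
  have := truncnS_gt (r0 * n%:R / 2); move: (Num.truncn _) => l.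
  by rewrite -[l.+1%:R]natr1; move: nr0 q1; set y := r0 * _; lra.
have Lm : (L <= m)%N.
  rewrite -(@ler_nat R); have : n%:R < (m%:R + 1) * p.+1%:R :> R.
    by rewrite natr1 -natrM ltr_nat.
  move=> nmR.
  have : L%:R * p.+1%:R <= n%:R / 4 :> R by nra.
  have : 2 * p.+1%:R <= n%:R :> R by rewrite -natrM ler_nat.
  move=> h1 h2; rewrite -(ler_pM2r q0); nra.
have LNk : (L <= Nk)%N by rewrite (leq_trans Lm)// /Nk leq_pmull.
(* The polynomial is at least M / (2K) in absolute value at the L sites preceding the node (k+1)/(p+1). *)
have big i : (i < n)%N -> (Nk - L <= i < Nk)%N -> M ^+ 2 / (4 * K ^+ 2) <= peval b (i.+1%:R / n%:R) ^+ 2.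
  move=> iltn /andP[i1 i2].
  pose x : R := i.+1%:R / n%:R.
  have x01 : 0 <= x <= 1 by rewrite divr_ge0 ?(ltW n0)//= ler_pdivrMr// mul1r ler_nat.
  have n01 : 0 <= node k <= 1 by rewrite divr_ge0//= ler_pdivrMr// mul1r ler_nat.
  have xn : `|x - node k| <= r0.
    have xE : i.+1%:R <= Nk%:R :> R by rewrite ler_nat.
    have xE2 : Nk%:R <= i.+1%:R + L%:R :> R by rewrite -natrD ler_nat; nat_lia.
    have e1 : Nk%:R * p.+1%:R <= k.+1%:R * n%:R :> R.
      by rewrite -!natrM ler_nat /Nk -mulnA leq_mul2l mn orbT.
    have e2 : k.+1%:R * n%:R <= (Nk%:R + p.+1%:R) * p.+1%:R :> R.
      rewrite -natrD -!natrM ler_nat /Nk mulnDl.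
      rewrite (leq_trans (leq_mul (leqnn k.+1) (ltnW nm)))// (mulSn m) mulnDr mulnA addnC.
      by rewrite leq_add2l leq_mul2r kp orbT.
    have nodeE : node k * (p.+1%:R * n%:R) = k.+1%:R * n%:R by rewrite /node; field; rewrite gt_eqF.
    have xxE : x * (p.+1%:R * n%:R) = i.+1%:R * p.+1%:R by rewrite /x; field; rewrite gt_eqF.
    have pn0 : 0 < p.+1%:R * n%:R :> R by rewrite mulr_gt0.
    rewrite ler_norml -(ler_pM2r pn0) -[X in _ && X](ler_pM2r pn0) !mulrBl nodeE xxE.
    have h : (r0 * n%:R / 2 + p.+1%:R) * p.+1%:R <= r0 * (p.+1%:R * n%:R).
      have -> : r0 * (p.+1%:R * n%:R) = (r0 * n%:R) * p.+1%:R by ring.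
      by rewrite ler_wpM2r//; lra.
    have h3 : i.+1%:R * p.+1%:R <= Nk%:R * p.+1%:R :> R by rewrite ler_wpM2r.
    have h4 : (Nk%:R + p.+1%:R) * p.+1%:R <= (i.+1%:R + (r0 * n%:R / 2 + p.+1%:R)) * p.+1%:R :> R.
      by rewrite ler_wpM2r//; lra.
    have h5 : 0 <= r0 * (p.+1%:R * n%:R) by rewrite mulr_ge0 ?(ltW r0_gt0) ?(ltW pn0).
    apply/andP; split; last by lra.
    by rewrite mulNr; rewrite mulrDl in h4; lra.
  have lip := peval_lipschitz bM x01 n01.
  have {lip} : `|peval b x - peval b (node k)| <= M / (2 * K).
    apply: (le_trans lip); have -> : M / (2 * K) = M * p.+1%:R ^+ 2 * r0.
      by rewrite /r0; field; rewrite !gt_eqF//; lra.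
    by rewrite ler_wpM2l// mulr_ge0 ?sqr_ge0 ?normr_ge0.
  move=> d1; have K0 : 0 < K by lra.
  have d2 : M / K <= `|peval b (node k)| by rewrite ler_pdivrMr// mulrC.
  have d3 : M / (2 * K) <= `|peval b x|.
    have := lerB_dist (peval b (node k)) (peval b (node k) - peval b x).
    rewrite opprB addrCA subrr addr0 distrC.
    have MK : M / K = 2 * (M / (2 * K)) by field; rewrite gt_eqF.
    by move: d1 d2; rewrite distrC MK; lra.
  rewrite -[leRHS]real_normK ?num_real//.
  have -> : M ^+ 2 / (4 * K ^+ 2) = (M / (2 * K)) ^+ 2 by field; rewrite gt_eqF.
  rewrite ler_pXn2r// nnegrE ?normr_ge0//.
  by rewrite divr_ge0 ?normr_ge0 ?mulr_ge0 ?(ltW K0).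
apply: (@le_trans _ _ (L%:R * (M ^+ 2 / (4 * K ^+ 2)))).
  have -> : r0 / (16 * K ^+ 2) * n%:R * M ^+ 2 = (r0 * n%:R / 4) * (M ^+ 2 / (4 * K ^+ 2)).
    by field; rewrite gt_eqF//; lra.
  by rewrite ler_wpM2r// divr_ge0 ?sqr_ge0// mulr_ge0 ?sqr_ge0.
rewrite -(big_mkord xpredT (fun i => peval b (i.+1%:R / n%:R) ^+ 2)).
rewrite (@big_cat_nat _ _ _ (Nk - L)%N)//=; last by nat_lia.
rewrite (@big_cat_nat _ _ _ Nk (Nk - L)%N)//=; last by nat_lia.
rewrite ler_wpDl ?sumr_ge0// => [i _|]; first exact: sqr_ge0.
rewrite ler_wpDr ?sumr_ge0// => [i _|]; first exact: sqr_ge0.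
apply: (@le_trans _ _ (\sum_(Nk - L <= i < Nk) (M ^+ 2 / (4 * K ^+ 2)))).
  by rewrite sumr_const_nat subKn// mulr_natl.
by apply: ler_sum_nat => i iL; apply: big => //; nat_lia.
Qed.

End polynomial_sums.

Definition power_col (R : realType) (n j : nat) : 'cV[R]_n := \col_i site R i ^+ j.

Definition in_box (R : realType) (lo hi : R) (theta : param R) : Prop :=
  [/\ lo <= theta.1.1 <= hi, lo <= theta.1.2 <= hi & lo <= theta.2 <= hi].

(** [W] is chosen before [theta], so the bound remains valid at an estimate of [theta] computed from
    the data. *)
Lemma envelope_covmx (R : realType) (lo hi : R) (q : nat) :
  0 < lo -> lo <= 1 -> 1 <= hi ->
  exists (C : R) (N : nat), forall n, (N <= n)%N -> exists W : 'I_n -> R,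
    [/\ forall i, 0 <= W i, \sum_i W i <= C &
      forall theta, in_box lo hi theta -> forall j, (j <= q)%N -> forall i,
        `|(invmx (covmx n theta) *m power_col R n j) i 0| <= W i].
Proof.
move=> lo0 lo1 hi1.
pose c := lo / (2 * hi).
pose D := (hi + q%:R ^+ 2 / lo) / lo + 2 * (q%:R + hi) / (lo * c).
exists (D * (2 / c + 1)), (maxn 4 (Num.truncn (4 / c ^+ 2)).+1) => n.
rewrite geq_max => /andP[n4 nN].
have nlarge : 4 / c ^+ 2 <= n%:R.
  by apply: (le_trans (ltW (truncnS_gt _))); rewrite ler_nat.
exists (fun i : 'I_n => envelope n c D i); split.
- by move=> i; exact: (@envelope_ge0 R lo hi c D q).
- exact: (@sum_envelope_le R lo hi c D q).
move=> [[v2 s2] kappa] [/= v_b s_b k_b] j jq i.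
have v0 : 0 < v2 by case/andP: v_b; lra.
have s0 : 0 < s2 by case/andP: s_b; lra.
have k0 : 0 < kappa by case/andP: k_b; lra.
have n2 : (1 < n)%N by nat_lia.
rewrite -extE; move: (nat_of_ord i) (ltn_ord i) => {}i ilt.
have r1 := decay_lt1 (leq_ltn_trans (leq0n _) n2) k0.
have r01 := decay_bounds n k0.
apply: (@stencil_compare R n (decay n kappa) n2 r01 (s2 * (1 - decay n kappa ^+ 2)) v2 _ _
  (stencil n (decay n kappa) (power_site R n j))) => //.
- rewrite mulr_gt0// subr_gt0 expr_lt1//; by case/andP: r01.
- exact: ltW.
- move=> k klt; rewrite stencil_covmx//.
  apply: eq_stencil => // l llt.
  by rewrite -[l]/(nat_of_ord (Ordinal llt)) extE mxE.
- by move=> k klt; exact: (@envelope_stencil R lo hi c D q).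
Qed.

(** [Sigma^-1] is bounded below by a multiple of [1/n], and the sum of squares of the polynomial by
    a multiple of [n b_j^2]. *)
Lemma qform_power_ge (R : realType) (p : nat) (lo hi : R) : 0 < lo -> lo <= 1 -> 1 <= hi ->
  exists c : R, 0 < c /\ exists N : nat, forall n, (N <= n)%N ->
  forall theta, in_box lo hi theta -> forall (b : 'I_p.+1 -> R) j,
    c * b j ^+ 2 <= qform (invmx (covmx n theta)) (\col_i peval b (site R i)).
Proof.
move=> lo0 lo1 hi1; have [c [c0 [N HN]]] := sum_peval_ge R p.
exists (c / (2 * hi)); split; first by rewrite divr_gt0//; lra.
exists (maxn N 1) => n; rewrite geq_max => /andP[nN n1] [[v2 s2] kappa] [/= v_b s_b k_b] b j.
have [v0 v1] : 0 < v2 /\ v2 <= hi by case/andP: v_b; lra.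
have [s0 s1] : 0 < s2 /\ s2 <= hi by case/andP: s_b; lra.
have k0 : 0 < kappa by case/andP: k_b; lra.
apply: le_trans (qform_invmx_covmx_ge v0 s0 k0 _).
rewrite -mulr_suml.
under eq_bigr do rewrite mxE.
have n1R : 1 <= n%:R :> R by rewrite ler1n.
have d0 : 0 < s2 * n%:R + v2 by rewrite addr_gt0// mulr_gt0//; lra.
rewrite ler_pdivlMr//; apply: le_trans (HN n nN b j).
have -> : c / (2 * hi) * b j ^+ 2 * (s2 * n%:R + v2) =
  c * b j ^+ 2 * ((s2 * n%:R + v2) / (2 * hi)) by ring.
have -> : c * n%:R * b j ^+ 2 = c * b j ^+ 2 * n%:R by ring.
apply: ler_wpM2l; first by rewrite mulr_ge0 ?sqr_ge0 ?(ltW c0).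
rewrite ler_pdivrMr; last by lra.
have : s2 * n%:R <= hi * n%:R by rewrite ler_wpM2r.
have : hi * 1 <= hi * n%:R by rewrite ler_wpM2l//; lra.
by lra.
Qed.

Section model_design.
Variables (R : realType) (p : nat) (a : {set 'I_p}).

(** The intercept column has exponent 0; regressor [j], counted from 0, has exponent [j + 1], whence
    [lift]. *)
Definition exponent (k : 'I_(1 + #|a|)) : 'I_p.+1 :=
  match fintype.split k with inl _ => ord0 | inr j => lift ord0 (enum_val j) end.

Lemma exponent_inj : injective exponent.
Proof.
move=> k l; rewrite /exponent -{2}(splitK k) -{2}(splitK l).
case: (fintype.split k) => [i|i]; case: (fintype.split l) => [j|j] //=.
- by rewrite !ord1.
- by move/lift_inj/enum_val_inj => ->.
Qed.

Lemma design_subE n i k :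
  design_sub (@monomial R p) n a i k = site R i ^+ exponent k.
Proof.
rewrite /design_sub /exponent mxE; case: fintype.split => j; rewrite !mxE//.
Qed.

(** The inner sum has at most one term, as [exponent] is injective, and is 0 for the powers outside
    the model. *)
Lemma design_sub_mulE n (b : 'cV[R]_(1 + #|a|)) :
  design_sub (@monomial R p) n a *m b =
  \col_i peval (fun j => \sum_(k | exponent k == j) b k 0) (site R i).
Proof.
apply/matrixP => i j; rewrite ord1 !mxE /peval.
under [RHS]eq_bigr do rewrite mulr_suml.
rewrite (exchange_big_dep xpredT) //=; apply: eq_bigr => k _.
by rewrite (big_pred1 (exponent k)) ?design_subE 1?mulrC// => l /=; rewrite eq_sym.
Qed.

Lemma exponent_coef (b : 'cV[R]_(1 + #|a|)) k :
  \sum_(l | exponent l == exponent k) b l 0 = b k 0.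
Proof. by rewrite (big_pred1 k)// => l; rewrite (inj_eq exponent_inj). Qed.

Variables (n : nat) (theta : param R) (c C : R) (W : 'I_n -> R).
Local Notation V := (invmx (covmx n theta)).
Local Notation X := (design_sub (@monomial R p) n a).
Local Notation H := (X^T *m V *m X).

Hypotheses (sV : V^T = V) (c_gt0 : 0 < c) (sumW : \sum_i W i <= C)
  (VW : forall j, (j <= p)%N -> forall i, `|(V *m power_col R n j) i 0| <= W i)
  (Vc : forall (b : 'I_p.+1 -> R) j, c * b j ^+ 2 <= qform V (\col_i peval b (site R i))).

Lemma gram_ge (b : 'cV[R]_(1 + #|a|)) k : c * b k 0 ^+ 2 <= qform H b.
Proof.
have -> : qform H b = qform V (X *m b) by rewrite /qform trmx_mul !mulmxA.
by rewrite design_sub_mulE -[in leLHS]exponent_coef; exact: Vc.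
Qed.

Lemma gram_posdef : posdef H.
Proof.
split; first by rewrite !trmx_mul trmxK sV mulmxA.
move=> b b0; have /existsP[k bk] : [exists k, b k 0 != 0].
  apply: contra_neqT b0; rewrite negb_exists => /forallP b0.
  by apply/matrixP => k j; rewrite ord1 mxE; apply/eqP; have := b0 k; rewrite negbK.
apply: lt_le_trans (gram_ge b k).
by rewrite mulr_gt0// lt0r sqrf_eq0 bk sqr_ge0.
Qed.

Lemma design_moment_le (z : 'cV[R]_n) k : `|(X^T *m V *m z) k 0| <= \sum_i W i * `|z i 0|.
Proof.
have -> : X^T *m V *m z = (V *m X)^T *m z by rewrite trmx_mul sV.
rewrite mxE (le_trans (ler_norm_sum _ _ _))//; apply: ler_sum => i _.
rewrite normrM ler_wpM2r// mxE.
have -> : (V *m X) i k = (V *m power_col R n (exponent k)) i 0.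
  by rewrite !mxE; apply: eq_bigr => l _; rewrite design_subE mxE.
by apply: VW; rewrite -ltnS.
Qed.

Lemma gram_le (b : 'cV[R]_(1 + #|a|)) (t : R) : (forall k, `|b k 0| <= t) ->
  qform H b <= C * ((1 + #|a|)%:R * t) ^+ 2.
Proof.
move=> bt; rewrite qformE.
have t0 : 0 <= t by apply: le_trans (bt ord0).
have C0 : 0 <= C.
  by apply: le_trans sumW; apply: sumr_ge0 => i _; apply: le_trans (VW (leq0n p) i).
apply: (@le_trans _ _ (\sum_(i < 1 + #|a|) \sum_(j < 1 + #|a|) C * t ^+ 2)); last first.
  rewrite sumr_const card_ord sumr_const card_ord -mulrnA -[leLHS]mulr_natr natrM.
  by rewrite (_ : _ * (_ * _) = C * ((1 + #|a|)%:R * t) ^+ 2)//; ring.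
apply: ler_sum => k _; apply: ler_sum => l _.
have hkl : `|H k l| <= C.
  have -> : H k l = (X^T *m V *m power_col R n (exponent l)) k 0.
    by rewrite !mxE; apply: eq_bigr => i _; rewrite design_subE [power_col _ _ _ _ _]mxE.
  apply: (le_trans (design_moment_le _ _)); apply: le_trans sumW.
  apply: ler_sum => i _; rewrite mxE ler_piMr//; last first.
    by rewrite ger0_norm ?exprn_ge0 ?exprn_ile1 ?divr_ge0// ler_pdivrMr ?mul1r ?ler_nat ?ltr0n// (leq_ltn_trans _ (ltn_ord i)).
  exact: le_trans (VW (leq0n p) i).
apply: (le_trans (ler_norm _)); rewrite !normrM expr2 mulrC.
by apply: ler_pM => //; rewrite ?mulr_ge0//; apply: ler_pM.
Qed.

(** For the largest coefficient [g m], the normal equations give [c |g m|^2 <= g' H g = g' X' V z <=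
    (1 + #|a|) |g m| Om], and one factor [|g m|] cancels. *)
Lemma gls_coef_le (z : 'cV[R]_n) k :
  `|gls_coef V X z k 0| <= (1 + #|a|)%:R / c * \sum_i W i * `|z i 0|.
Proof.
set g := gls_coef V X z; set Om := \sum_i _.
case: (@Order.TotalTheory.arg_maxP _ R _ (ord0 : 'I_(1 + #|a|)) xpredT (fun k => `|g k 0|)) => //= m _ gm.
apply: (le_trans (gm k isT)).
have Om0 : 0 <= Om.
  by apply: sumr_ge0 => i _; rewrite mulr_ge0//; apply: le_trans (VW (leq0n p) i).
have := gram_ge g m; rewrite /qform -mulmxA (gls_normal_eq (posdef_unitmx gram_posdef)).
rewrite [X in _ <= X -> _]mxE -real_normK ?num_real// => gH.
have {}gH : c * `|g m 0| ^+ 2 <= (1 + #|a|)%:R * (`|g m 0| * Om).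
  apply: (le_trans gH); apply: (@le_trans _ _ (\sum_(j < 1 + #|a|) `|g m 0| * Om)).
    apply: ler_sum => j _; rewrite mxE (le_trans (ler_norm _))// normrM.
    by apply: ler_pM => //; [exact: gm|exact: design_moment_le].
  by rewrite sumr_const card_ord mulr_natl.
have [->|g0] := eqVneq (g m 0) 0.
  by rewrite normr0 mulr_ge0// divr_ge0// ltW.
have gp : 0 < `|g m 0| by rewrite normr_gt0.
rewrite -(ler_pM2l c_gt0) -(ler_pM2r gp).
have -> : c * ((1 + #|a|)%:R / c * Om) * `|g m 0| = (1 + #|a|)%:R * (`|g m 0| * Om).
  by field; rewrite gt_eqF.
by rewrite -mulrA -expr2.
Qed.

End model_design.

(** * Likelihood *)

Lemma compact_in_box (R : realType) (Theta : set (param R)) :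
  compact (Theta : set (R * R * R)%type) -> Theta !=set0 ->
  (forall v2 sigma2 kappa, Theta (v2, sigma2, kappa) ->
     [/\ 0 < v2, 0 < sigma2 & 0 < kappa]) ->
  exists lo hi : R, [/\ 0 < lo, lo <= 1, 1 <= hi &
    forall theta, Theta theta -> in_box lo hi theta].
Proof.
move=> cT nT posT.
have bnd (f : R * R * R -> R) : continuous f -> (forall t, Theta t -> 0 < f t) ->
    exists l h : R, [/\ 0 < l, l <= 1, 1 <= h & forall t, Theta t -> l <= f t <= h].
  move=> cf f0; have wcf : {within Theta, continuous f} by exact: continuous_subspaceT.
  have [m mT mP] := compact_EVT_min nT cT wcf.
  have [M MT MP] := compact_EVT_max nT cT wcf.
  exists (Num.min 1 (f m)), (Num.max 1 (f M)); split.
  - by rewrite lt_min ltr01 f0//; rewrite in_setE in mT.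
  - by rewrite ge_min lexx.
  - by rewrite le_max lexx.
  - by move=> t tT; rewrite ge_min le_max mP ?MP ?orbT// mem_set.
have c1 : continuous (fun t : R * R * R => t.1.1).
  by move=> t; apply: (@cvg_comp _ _ _ fst fst); exact: cvg_fst.
have c2 : continuous (fun t : R * R * R => t.1.2).
  by move=> t; apply: (@cvg_comp _ _ _ fst snd); [exact: cvg_fst|exact: cvg_snd].
have c3 : continuous (fun t : R * R * R => t.2) by move=> t; exact: cvg_snd.
have [|l1 [h1 [l10 l11 h11 b1]]] := bnd _ c1; first by move=> [[? ?] ?] /posT[].
have [|l2 [h2 [l20 l21 h21 b2]]] := bnd _ c2; first by move=> [[? ?] ?] /posT[].
have [|l3 [h3 [l30 l31 h31 b3]]] := bnd _ c3; first by move=> [[? ?] ?] /posT[].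
exists (Num.min l1 (Num.min l2 l3)), (Num.max h1 (Num.max h2 h3)); split.
- by rewrite !lt_min l10 l20.
- by rewrite ge_min l11.
- by rewrite le_max h11.
- move=> t tT; have /andP[? ?] := b1 t tT; have /andP[? ?] := b2 t tT; have /andP[? ?] := b3 t tT.
  split; apply/andP; split; rewrite !(ge_min, le_max);
    match goal with H : is_true ?b |- context [?b] => rewrite H end; by rewrite ?orbT.
Qed.

Lemma continuous_sum_ord (R : realType) (T : topologicalType) n (F : 'I_n -> T -> R) :
  (forall i, continuous (F i)) -> continuous (fun x => \sum_i F i x).
Proof.
move=> cF; apply: (@continuous_big _ _ +%R) => [|i _]; first exact: add_continuous.
exact: cF.
Qed.

Section likelihood.
Variables (R : realType) (p n : nat) (theta : param R).
Local Notation V := (invmx (covmx n theta)).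
Local Notation X a := (design_sub (@monomial R p) n a).
Local Notation H a := ((X a)^T *m V *m X a).
Local Notation ll := (loglik (@monomial R p)).

(** Common to all models at a given [theta], hence cancelled in the comparisons below. *)
Definition loglik_const : R := - (n%:R / 2) * ln (2 * pi) - 2^-1 * ln (\det (covmx n theta)).

Lemma loglik_glsE z a :
  ll z a theta = loglik_const - 2^-1 * qform V (z - X a *m gls_coef V (X a) z).
Proof.
rewrite /loglik /loglik_const /mu_hat /qform /gls_coef; congr (_ - _ * _).
by rewrite !mulmxA.
Qed.

Hypotheses (sV : V^T = V).

Lemma loglikE z a b : posdef (H a) ->
  ll z a theta = loglik_const - 2^-1 * (qform V (z - X a *m b) - qform (H a) (b - gls_coef V (X a) z)).
Proof.
move=> pH; rewrite loglik_glsE (gls_pythagoras sV (posdef_unitmx pH) z b).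
by rewrite addrK.
Qed.

Lemma loglik_ge z a : posdef (H a) -> loglik_const - 2^-1 * qform V z <= ll z a theta.
Proof.
move=> pH; rewrite (loglikE z 0 pH) mulmx0 subr0 lerD2l lerN2 ler_wpM2l ?invr_ge0//.
by rewrite gerBl; exact: posdef_ge0.
Qed.

Lemma loglik_shift z a b : posdef (H a) -> ll (z - X a *m b) a theta = ll z a theta.
Proof.
move=> pH; rewrite !loglik_glsE (gls_coef_shift (posdef_unitmx pH)).
by rewrite mulmxBr opprB addrA subrK.
Qed.

(* Subtracting the fitted mean from the data costs the full model nothing, and makes
   any other model fit at least as well as the mean zero. *)
Lemma loglik_sub_le z a a' b : posdef (H a) -> posdef (H a') ->
  2 * (ll z a theta - ll (z - X a *m b) a' theta) <= qform (H a) (b - gls_coef V (X a) z).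
Proof.
move=> pa pa'; have := loglik_ge (z - X a *m b) pa'.
by rewrite (loglikE z b pa); lra.
Qed.

(** The residual is the fixed matrix [P] applied to the data, so the likelihood is a quadratic
    polynomial in [x]. The affine argument is the form in which Gaussian data enter. *)
Lemma continuous_loglik_affine a (d : 'cV[R]_n) (B : 'M[R]_n) :
  continuous (fun x => ll (d + B *m x) a theta).
Proof.
pose P := 1%:M - X a *m invmx (H a) *m (X a)^T *m V.
have -> : (fun x => ll (d + B *m x) a theta) =
    (fun x => loglik_const - 2^-1 * qform V (P *m d + (P *m B) *m x)).
  apply/funext => x; rewrite loglik_glsE; congr (_ - _ * qform _ _).
  by rewrite /P /gls_coef -!mulmxA -mulmxDr mulmxBl mul1mx !mulmxA.
have cc (u : 'cV[R]_n) (M : 'M[R]_n) i : continuous (fun x => (u + M *m x) i 0).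
  have -> : (fun x => (u + M *m x) i 0) = (fun x : 'cV[R]_n => u i 0 + \sum_j M i j * x j 0).
    by apply/funext => x; rewrite !mxE.
  move=> x; apply: (@cvgD _ R^o _ (nbhs x)); first exact: cvg_cst.
  apply: (continuous_sum_ord (F := fun j (x : 'cV[R]_n) => M i j * x j 0)) => j y.
  by apply: (@cvgM _ _ (nbhs y)); [exact: cvg_cst|exact: coord_continuous].
have -> : (fun x => loglik_const - 2^-1 * qform V (P *m d + (P *m B) *m x)) =
    (fun x => loglik_const - 2^-1 * \sum_i \sum_j (P *m d + (P *m B) *m x) i 0 *
       (P *m d + (P *m B) *m x) j 0 * V i j).
  by apply/funext => x; rewrite qformE.
move=> x; apply: (@cvgB _ R^o _ (nbhs x)); first exact: cvg_cst.
apply: (@cvgM _ _ (nbhs x)); first exact: cvg_cst.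
apply: (continuous_sum_ord (F := fun i (x : 'cV[R]_n) => \sum_j (P *m d + (P *m B) *m x) i 0 *
  (P *m d + (P *m B) *m x) j 0 * V i j)) => i.
apply: (continuous_sum_ord (F := fun j (x : 'cV[R]_n) => (P *m d + (P *m B) *m x) i 0 *
  (P *m d + (P *m B) *m x) j 0 * V i j)) => j y.
apply: (@cvgM _ _ (nbhs y)); last exact: cvg_cst.
by apply: (@cvgM _ _ (nbhs y)); exact: cc.
Qed.

End likelihood.

(** * Tightness and contiguity *)

(** The event expresses that the supremum of [l1] over [D] is below that of [l2] plus [e]. With a
    rational threshold it is a countable union of intersections of a closed and an open set, however
    large [D] is. *)
Lemma boxes_dominated (R : realType) (n : nat) (I : Type) (D : set I)
    (l1 l2 : I -> 'cV[R]_n -> R) (e : R) :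
  (forall t, continuous (l1 t)) -> (forall t, continuous (l2 t)) ->
  <<s @boxes R n >> [set x | exists q : rat, (forall t, D t -> l1 t x <= ratr q) /\
    exists t, D t /\ ratr q - e < l2 t x].
Proof.
move=> c1 c2; pose X := g_sigma_algebraType (@boxes R n).
have oU (l : I -> 'cV[R]_n -> R) (s : R) : (forall t, continuous (l t)) ->
    open [set x | exists t, D t /\ s < l t x].
  move=> cl; rewrite (_ : [set _ | _] = \bigcup_(t in D) (l t @^-1` [set y | s < y])).
    by apply: bigcup_open => t _; apply: open_comp => [x _|]; [exact: cl|exact: open_gt].
  by apply/seteqP; split => [x [t [Dt h]]|x [t Dt h]]; exists t.
rewrite (_ : [set _ | _] = \bigcup_q
   ((~` [set x : X | exists t, D t /\ ratr q < l1 t x]) `&`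
    [set x | exists t, D t /\ ratr q - e < l2 t x])); last first.
  apply/seteqP; split => [x [q [h1 h2]]|x [q _ [h1 h2]]].
    exists q => //; split => // -[t [Dt]].
    by rewrite ltNge h1.
  exists q; split => // t Dt; rewrite leNgt; apply/negP => h.
  by apply: h1; exists t.
apply: (@bigcupT_measurable_rat _ X) => q; apply: (@measurableI _ X).
  by apply: (@measurableC _ X); apply: open_boxes; exact: oU.
by apply: open_boxes; exact: oU.
Qed.

Section gaussian_vector.
Context d (T : measurableType d) (R : realType) (P : probability T R) (n : nat).
Variables (Z : T -> 'cV[R]_n) (mu : 'cV[R]_n) (Sigma : 'M[R]_n).
Hypothesis ZP : gaussian_vector P Z mu Sigma.

Lemma gaussian_vector_measurable i : measurable_fun setT (fun w => Z w i 0).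
Proof.
have [A [xi [_ [mxi _] ZE]]] := ZP.
under eq_fun do rewrite ZE !mxE.
apply: measurable_funD => //; apply: measurable_sum => k.
by apply: measurable_funM => //; exact: mxi.
Qed.

Lemma gaussian_vector_abs_le i :
  (\int[P]_w `|Z w i 0|%:E <= (`|mu i 0| + 2 * expR (Sigma i i / 2))%:E)%E.
Proof.
have [A [xi [AS xiP ZE]]] := ZP.
have mxi := measurable_gaussian_coord xiP.
have := gaussian_linear_abs_le xiP (\col_k A i k).
have -> : \sum_k (\col_k A i k) k 0 ^+ 2 = Sigma i i.
  by rewrite -AS mxE; apply: eq_bigr => k _; rewrite !mxE expr2.
move=> H.
apply: (@le_trans _ _ (\int[P]_w (`|mu i 0|%:E +
   `|\sum_k (\col_k A i k) k 0 * xi w k 0|%:E)%E)%E).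
  have mS : measurable_fun setT (fun w => \sum_k (\col_k A i k) k 0 * xi w k 0).
    by apply: measurable_sum => k; apply: measurable_funM => //; exact: mxi.
  apply: ge0_le_integral => //.
  - by apply/measurable_EFinP; apply: measurableT_comp => //; exact: gaussian_vector_measurable.
  - by apply/measurable_EFinP; apply: measurable_funD => //; exact: measurableT_comp.
  move=> w _; rewrite -EFinD lee_fin ZE mxE (le_trans (ler_normD _ _))// lerD2l.
  by rewrite mxE; under [in leRHS]eq_bigr do rewrite mxE.
rewrite ge0_integralD//.
- rewrite integral_cst// [X in (_ * X)%E](_ : _ = 1%E); last exact: probability_setT.
  by rewrite mule1 EFinD leeD2l.
- apply/measurable_EFinP; apply: measurableT_comp => //.
  by apply: measurable_sum => k; apply: measurable_funM => //; exact: mxi.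
Qed.

Lemma measurable_weighted_sum (W : 'I_n -> R) :
  measurable_fun setT (fun w => \sum_i W i * `|Z w i 0|).
Proof.
apply: measurable_sum => i; apply: measurable_funM => //.
by apply: measurableT_comp => //; exact: gaussian_vector_measurable.
Qed.

Lemma measurable_weighted_sum_ge (W : 'I_n -> R) (M : R) :
  measurable [set w | M <= \sum_i W i * `|Z w i 0|].
Proof.
rewrite (_ : [set w | _] = setT `&` (fun w => \sum_i W i * `|Z w i 0|) @^-1` `[M, +oo[%classic).
  by apply: measurable_weighted_sum => //; exact: measurable_itv.
by rewrite setTI; apply/seteqP; split => w /=; rewrite in_itv/= andbT.
Qed.

(** Markov's inequality, the mean of the sum being at most [m] times the total weight. *)
Lemma weighted_sum_tail (W : 'I_n -> R) (m M : R) : (forall i, 0 <= W i) -> 0 < M ->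
  (forall i, (\int[P]_w `|Z w i 0|%:E <= m%:E)%E) ->
  (P [set w | (M <= \sum_i W i * `|Z w i 0|)%R] <= (m * (\sum_i W i)%R / M)%:E)%E.
Proof.
move=> W0 M0 mZ; pose Om w := \sum_i W i * `|Z w i 0|.
have mA i : measurable_fun setT (fun w => W i * `|Z w i 0|).
  apply: measurable_funM => //; apply: measurableT_comp => //.
  exact: gaussian_vector_measurable.
have mOm : measurable_fun setT Om := measurable_weighted_sum W.
have mE : measurable [set w | M <= Om w] := measurable_weighted_sum_ge W M.
have intOm : (\int[P]_w (Om w)%:E <= (m * \sum_i W i)%:E)%E.
  under eq_integral do rewrite /Om -sumEFin.
  rewrite ge0_integral_sum//; last 2 first.
  - by move=> i; exact/measurable_EFinP.
  - by move=> i w _; rewrite lee_fin mulr_ge0.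
  rewrite mulr_sumr -sumEFin; apply: lee_sum => i _.
  under eq_integral do rewrite EFinM.
  rewrite ge0_integralZl//; last 2 first.
  - apply/measurable_EFinP; apply: measurableT_comp => //; exact: gaussian_vector_measurable.
  - by rewrite lee_fin.
  by rewrite mulrC EFinM lee_wpmul2l// lee_fin.
rewrite EFinM lee_pdivlMr// muleC.
apply: le_trans intOm.
apply: (@le_trans _ _ (\int[P]_(w in [set w | (M <= Om w)%R]) cst M%:E w)%E).
  by rewrite integral_cst.
apply: (@le_trans _ _ (\int[P]_(w in [set w | (M <= Om w)%R]) (Om w)%:E)%E).
  apply: ge0_le_integral => //.
  - by move=> w _; rewrite lee_fin ltW.
  - by apply/measurable_EFinP; exact: measurable_funTS.
apply: ge0_subset_integral => //; first exact/measurable_EFinP.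
by move=> w _; rewrite lee_fin sumr_ge0// => i _; rewrite mulr_ge0.
Qed.

(** Moving [Z] by [- u] amounts to moving [xi] by [h = - A' Sigma^-1 u], because [A A' = Sigma]; and
    [|h|^2 = u' Sigma^-1 u]. *)
Lemma gaussian_vector_shift_le (u : 'cV[R]_n) (G : set 'cV[R]_n) (lam : R) :
  Sigma \in unitmx -> Sigma^T = Sigma -> 0 < lam ->
  (forall e (B : 'M[R]_n), <<s @boxes R n >> [set x | G (e + B *m x)]) ->
  (P [set w | G (Z w - u)%R] <=
   lam%:E * P [set w | G (Z w)] + (expR (qform (invmx Sigma) u) / lam)%:E)%E.
Proof.
move=> uS sS lam0 mG; have [A [xi [AS xiP ZE]]] := ZP.
pose y := invmx Sigma *m u; pose h := - (A^T *m y).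
have Ah : A *m h = - u by rewrite /h mulmxN mulmxA AS /y mulKVmx.
have := @gaussian_shift_le _ _ _ P n xi xiP h [set x | G (mu + A *m x)] lam (mG mu A) lam0.
have -> : [set w | [set x | G (mu + A *m x)] (xi w + h)] = [set w | G (Z w - u)].
  by apply/seteqP; split => w /=; rewrite mulmxDr Ah addrA -ZE.
have -> : xi @^-1` [set x | G (mu + A *m x)] = [set w | G (Z w)].
  by apply/seteqP; split => w /=; rewrite -ZE.
have -> : \sum_i h i 0 ^+ 2 = qform (invmx Sigma) u.
  transitivity ((h^T *m h) 0 0).
    by rewrite [RHS]mxE; apply: eq_bigr => i _; rewrite [h^T _ _]mxE expr2.
  rewrite /h [(- _)^T]linearN /= mulNmx mulmxN opprK trmx_mul trmxK /qform.
  by rewrite -!mulmxA (mulmxA A) AS /y mulKVmx// trmx_mul trmx_inv sS mulmxA.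
by [].
Qed.

End gaussian_vector.

Section sequences_of_probabilities.
Variable R : realType.

Lemma cvg_probability1 (u : nat -> \bar R) :
  (\forall n \near \oo, (0 <= u n)%E /\ (u n <= 1)%E) ->
  (forall e : R, 0 < e -> \forall n \near \oo, ((1 - e)%:E <= u n)%E) ->
  u n @[n --> \oo] --> 1%E.
Proof.
move=> u01 H.
have uf n : (0 <= u n)%E -> (u n <= 1)%E -> u n = (fine (u n))%:E.
  by move=> u0 u1; rewrite fineK// ge0_fin_numE// (le_lt_trans u1)// ltry.
apply/fine_cvgP; split.
  by apply: filterS u01 => n [u0 u1]; rewrite uf.
apply/cvgrPdist_le => e e0; near=> n.
have [u0 u1] : (0 <= u n)%E /\ (u n <= 1)%E by near: n.
have : ((1 - e)%:E <= u n)%E by near: n; exact: H.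
have uE := uf n u0 u1; move: u1; rewrite uE !lee_fin => u1 u2 /=.
by rewrite ger0_norm ?subr_ge0//; lra.
Unshelve. all: by end_near. Qed.

Lemma limn_esup_le_near (u : nat -> \bar R) (x : \bar R) :
  (\forall n \near \oo, (u n <= x)%E) -> (limn_esup u <= x)%E.
Proof.
move=> H; apply: ge_ereal_inf; exists (ereal_sup (u @` [set n | (u n <= x)%E])).
  by exists [set n | (u n <= x)%E].
by apply: ge_ereal_sup => _ [n un <-].
Qed.

Lemma limn_einf_gt0 (u : nat -> R) : (0 < limn_einf (fun n => (u n)%:E))%E ->
  exists c, 0 < c /\ \forall n \near \oo, c <= u n.
Proof.
rewrite /limn_einf oppe_gt0 => /ereal_inf_lt[_ [V Voo <-]] s0.
have H n : V n -> ((- u n)%:E <= ereal_sup ((\- (fun n => (u n)%:E))%E @` V))%E.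
  by move=> Vn; apply: ereal_sup_ubound; exists n.
move: s0 H; case: (ereal_sup _) => [s|//|_ H].
  rewrite lte_fin => s0 H; exists (- s); split; first by rewrite oppr_gt0.
  by apply: filterS Voo => n /H; rewrite lee_fin => ?; lra.
(* Here the supremum is [-oo], which no real [- u n] can lie below, so any constant serves on
   [V]. *)
exists 1; split => //; apply: filterS Voo => n /H.
by rewrite leeNy_eq.
Qed.

End sequences_of_probabilities.

Lemma in_box_posdef (R : realType) (lo hi : R) n theta :
  0 < lo -> in_box lo hi theta -> posdef (covmx n theta).
Proof.
case: theta => [[v2 s2] kappa] lo0 [/andP[v _] /andP[s _] /andP[k _]].
by apply: covmx_posdef; [exact: lt_le_trans v|exact: lt_le_trans s|exact: lt_le_trans k].
Qed.

(** All that the selection argument needs to know about the likelihood, with one constant [C] for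
    all large [n] and one weight [W] for all parameters and models. The first bound holds for any
    [b], fitted only up to an error [t], so that [b] may be taken from a finite grid. *)
Lemma uniform_likelihood_bounds (R : realType) (p : nat) (lo hi : R) :
  0 < lo -> lo <= 1 -> 1 <= hi ->
  exists (C : R) (N : nat), 0 < C /\ forall n, (N <= n)%N -> exists W : 'I_n -> R,
  [/\ forall i, 0 <= W i, \sum_i W i <= C &
  forall theta, in_box lo hi theta -> forall a : {set 'I_p},
  let X := design_sub (@monomial R p) n a in
  let V := invmx (covmx n theta) in
  let ll := loglik (@monomial R p) (n := n) in
  [/\ forall a' z (b : 'cV[R]_(1 + #|a|)) (t : R), (forall k, `|(b - gls_coef V X z) k 0| <= t) ->
        2 * (ll z a theta - ll (z - X *m b) a' theta) <= C * t ^+ 2,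
      forall z b, ll (z - X *m b) a theta = ll z a theta,
      forall z k, `|gls_coef V X z k 0| <= C * \sum_i W i * `|z i 0| &
      forall (b : 'cV[R]_(1 + #|a|)) (t : R), (forall k, `|b k 0| <= t) -> qform V (X *m b) <= C * t ^+ 2]].
Proof.
move=> lo0 lo1 hi1.
have [C0 [N1 HW]] := envelope_covmx p lo0 lo1 hi1.
have [c [c0 [N2 Hc]]] := qform_power_ge p lo0 lo1 hi1.
pose q : R := p.+1%:R; have q0 : 0 < q by rewrite ltr0n.
pose C := 1 + `|C0| + `|C0| * q ^+ 2 + q / c.
have C_ge1 : [/\ 1 <= C, C0 <= C, `|C0| * q ^+ 2 <= C & q / c <= C].
  have := normr_ge0 C0; have : 0 <= `|C0| * q ^+ 2 by rewrite mulr_ge0 ?sqr_ge0.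
  have : 0 <= q / c by rewrite divr_ge0 ?ltW.
  have := ler_norm C0; rewrite /C; split; lra.
have [C1 CC0 Cq Cc] := C_ge1.
exists C, (maxn N1 N2); split; first by lra.
move=> n; rewrite geq_max => /andP[n1 n2].
have [W [W0 sW HW']] := HW n n1; exists W; split => //; first exact: le_trans CC0.
move=> theta bx a X V ll.
have vp : posdef (covmx n theta).
  exact: in_box_posdef lo0 bx.
have [sV _] : posdef V := posdef_invmx vp.
have VW := HW' theta bx; have Vc := Hc n n2 theta bx.
have pH b := gram_posdef b sV c0 Vc.
have rq : (1 + #|a|)%:R <= q.
  by rewrite ler_nat add1n ltnS -[X in (_ <= X)%N](card_ord p) max_card.
have gle (b : 'cV[R]_(1 + #|a|)) (t : R) : (forall k, `|b k 0| <= t) ->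
    qform (X^T *m V *m X) b <= C * t ^+ 2.
  move=> bt; have t0 : 0 <= t by apply: le_trans (bt ord0).
  apply: (le_trans (gram_le sV (le_trans sW (ler_norm _)) VW bt)).
  rewrite exprMn mulrA ler_wpM2r ?sqr_ge0//; apply: le_trans Cq.
  by rewrite ler_wpM2l// ler_pXn2r// nnegrE ?ler0n// ltW.
split.
- move=> a' z b t bt; apply: le_trans (gle _ _ bt).
  by apply: loglik_sub_le.
- by move=> z b; exact: loglik_shift.
- move=> z k; apply: (le_trans (gls_coef_le sV c0 VW Vc z k)).
  rewrite ler_wpM2r//; first by apply: sumr_ge0 => i _; rewrite mulr_ge0.
  by apply: le_trans Cc; rewrite ler_wpM2r// invr_ge0 ltW.
- move=> b t bt; have -> : qform V (X *m b) = qform (X^T *m V *m X) b.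
    by rewrite /qform trmx_mul !mulmxA.
  exact: gle.
Qed.

Lemma polynomial_data_abs_le (R : realType) (p n : nat) (beta0 : 'cV[R]_p.+1)
    (v2 s2 kappa : R) d (T : measurableType d) (P : probability T R) (Z : T -> 'cV[R]_n) i :
  gaussian_vector P Z (design (@monomial R p) n *m beta0) (covmx n (v2, s2, kappa)) ->
  (\int[P]_w `|Z w i 0|%:E <= (\sum_j `|beta0 j 0| + 2 * expR ((s2 + v2) / 2))%:E)%E.
Proof.
move=> /gaussian_vector_abs_le/(_ i)/le_trans; apply; rewrite lee_fin lerD//.
  rewrite mxE (le_trans (ler_norm_sum _ _ _))//.
  apply: ler_sum => j _; rewrite normrM ler_piMl//.
  have s01 : 0 <= site R i <= 1.
    rewrite /site divr_ge0//= ler_pdivrMr ?mul1r ?ler_nat//.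
    by rewrite ltr0n (leq_ltn_trans _ (ltn_ord i)).
  rewrite /design mxE; case: fintype.split => k; rewrite !mxE ?normr1//.
  by case/andP: s01 => s0 s1; rewrite /monomial ger0_norm ?exprn_ge0 ?exprn_ile1.
by rewrite covmxE eqxx mulr1n /geo subnn expr0 mulr1.
Qed.

(** * Model selection *)

(** Subtracting [K] recentres the indices [0, ..., 2K] to [-K, ..., K]. *)
Definition grid_point (R : realType) (r K : nat) (eta : R)
    (l : {ffun 'I_r -> 'I_(2 * K).+1}) : 'cV[R]_r :=
  \col_k (eta * ((l k)%:R - K%:R)).

Lemma grid_point_le (R : realType) (r K : nat) (eta : R) (l : {ffun 'I_r -> 'I_(2 * K).+1}) k :
  0 < eta -> `|grid_point eta l k 0| <= eta * K%:R.
Proof.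
move=> e0; rewrite mxE normrM gtr0_norm// ler_wpM2l ?(ltW e0)//.
have : (l k)%:R <= 2 * K%:R :> R by rewrite -natrM ler_nat -ltnS.
have : 0 <= (l k)%:R :> R by [].
by move: ((l k)%:R : R) => x x0 xK; rewrite ler_norml; apply/andP; split; lra.
Qed.

Lemma grid_point_approx (R : realType) (r K : nat) (eta : R) (g : 'cV[R]_r) : 0 < eta ->
  (forall k, `|g k 0| <= eta * K%:R) ->
  exists l : {ffun 'I_r -> 'I_(2 * K).+1}, forall k, `|(grid_point eta l - g) k 0| <= eta.
Proof.
move=> e0 gK; pose x k := g k 0 / eta + K%:R.
have xb k : 0 <= x k <= 2 * K%:R.
  have : `|g k 0 / eta| <= K%:R.
    by rewrite normrM normfV (gtr0_norm e0) ler_pdivrMr// mulrC.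
  by rewrite ler_norml /x => /andP[? ?]; apply/andP; split; lra.
have tx k : (Num.truncn (x k) < (2 * K).+1)%N.
  rewrite ltnS truncn_le_nat; have /andP[_ xk] := xb k.
  by rewrite (le_lt_trans xk)// -natrM ltr_nat.
exists [ffun k => Ordinal (tx k)] => k; rewrite !mxE ffunE /=.
have /andP[t1 t2] := truncn_itv (andP (xb k)).1; rewrite -[_.+1%:R]natr1 in t2.
have -> : eta * ((Num.truncn (x k))%:R - K%:R) - g k 0 = eta * ((Num.truncn (x k))%:R - x k).
  by rewrite /x; field; rewrite gt_eqF.
rewrite normrM gtr0_norm// ler_piMr ?(ltW e0)// ler_norml; apply/andP; split; lra.
Qed.

Lemma set0_nested_models p : finset.set0 \in nested_models p.
Proof.
by apply/imsetP; exists ord0 => //; apply/setP => j.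
Qed.

Section selection.
Variables (R : realType) (p : nat) (Theta : set (param R)).
Variables (n : nat) (z : 'cV[R]_n) (th : {set 'I_p} -> param R) (tau : R) (ah : {set 'I_p}).
Hypotheses
  (ml : forall a, a \in nested_models p -> is_ml (@monomial R p) Theta z a (th a))
  (sel : is_gic_selection (@monomial R p) (nested_models p) tau z th ah).
Local Notation ll := (loglik (@monomial R p) z).

Lemma ml_ge a theta : a \in nested_models p -> Theta theta -> ll a theta <= ll a (th a).
Proof.
move=> /ml[_ E] Tt; rewrite -lee_fin E; apply: ereal_sup_ubound.
by exists theta.
Qed.

(** The empty model carries no penalty, and its maximized likelihood is at least its likelihood at
    any [theta]. The free choice of [theta] allows both models to be compared at one parameter. *)
Lemma selected_penalty_le theta : Theta theta ->
  tau * #|ah|%:R <= 2 * (ll ah (th ah) - ll finset.set0 theta).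
Proof.
move=> Tt; case: sel => ahin /(_ finset.set0 (set0_nested_models p)).
rewrite /gic cards0 mulr0 addr0.
by have := ml_ge (set0_nested_models p) Tt; lra.
Qed.

End selection.

Unset Implicit Arguments.

(* For n > p the sites are n >= p + 1 distinct points, so every
   X(a)' Sigma^-1 X(a) is invertible; for smaller n nothing is assumed.
   "lim P < 1" in the second claim is read as limsup P < 1, since tau is not
   assumed to converge and the limit need not exist. *)
Theorem theorem5p5 (R : realType) (p : nat)
  (beta0 : 'cV[R]_(p.+1)) (v02 sigma02 kappa0 : R) (Theta : set (param R))
  (d : nat -> measure_display) (T : forall n : nat, measurableType (d n))
  (P : forall n : nat, probability (T n) R)
  (Z : forall n : nat, T n -> 'cV[R]_n)
  (tau : nat -> R)
  (theta_hat : forall n : nat, T n -> {set 'I_p} -> param R)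
  (alpha_hat : forall n : nat, T n -> {set 'I_p})
  (alpha0 : {set 'I_p})
  (Theta_pos : forall v2 sigma2 kappa : R, Theta (v2, sigma2, kappa) ->
     [/\ 0 < v2, 0 < sigma2 & 0 < kappa])
  (Theta_compact : compact (Theta : set (R * R * R)%type))
  (theta0_in : Theta (v02, sigma02, kappa0))
  (theta0_shift : forall k : nat, (k <= p)%N ->
     Theta (v02, sigma02 + gam beta0 k,
            kappa0 - (sigma02 + gam beta0 k)^-1 * gam beta0 k * kappa0))
  (Z_gaussian : forall n : nat, (p < n)%N ->
     gaussian_vector (P n) (Z n)
       (design (@monomial R p) n *m beta0) (covmx n (v02, sigma02, kappa0)))
  (theta_hat_ml : forall n : nat, (p < n)%N ->
     forall (w : T n) (a : {set 'I_p}), a \in nested_models p ->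
     is_ml (@monomial R p) Theta (Z n w) a (theta_hat n w a))
  (alpha_hat_gic : forall n : nat, (p < n)%N -> forall w : T n,
     is_gic_selection (@monomial R p) (nested_models p) (tau n) (Z n w)
       (theta_hat n w) (alpha_hat n w))
  (alpha_hat_meas : forall n : nat, (p < n)%N -> forall a : {set 'I_p},
     measurable [set w : T n | alpha_hat n w = a])
  (alpha0_smallest :
     smallest_correct (@monomial R p) (nested_models p) beta0 alpha0) :
  (tau n @[n --> \oo] --> +oo ->
     P n [set w : T n | alpha_hat n w = finset.set0] @[n --> \oo] --> 1%E)
  /\
  (alpha0 <> finset.set0 ->
     (0 < limn_einf (fun n => (tau n)%:E))%E ->
     (limn_esup (fun n => P n [set w : T n | alpha_hat n w = alpha0]) < 1)%E).
Proof.
have [|lo [hi [lo0 lo1 hi1 box]]] := compact_in_box Theta_compact _ Theta_pos.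
  by exists (v02, sigma02, kappa0).
have [C [N0 [C0 HN0]]] := uniform_likelihood_bounds p lo0 lo1 hi1.
(* Bound for the mean of [|Z_i|], uniform in [n] and [i]. *)
pose m := \sum_j `|beta0 j 0| + 2 * expR ((sigma02 + v02) / 2).
have m0 : 0 < m.
  by rewrite ltr_wpDl ?sumr_ge0// mulr_gt0// expR_gt0.
have tail (M : R) n (W : 'I_n -> R) : 0 < M -> (p < n)%N -> (forall i, 0 <= W i) ->
    \sum_i W i <= C ->
    (P n [set w | (M <= \sum_i W i * `|Z n w i 0|)%R] <= (m * C / M)%:E)%E.
  move=> M0 pn W0 WC.
  apply: (le_trans (weighted_sum_tail (m := m) (Z_gaussian n pn) W0 M0 _)).
    by move=> i; exact: polynomial_data_abs_le (Z_gaussian n pn).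
  by rewrite lee_fin ler_wpM2r ?invr_ge0 ?(ltW M0)// ler_wpM2l ?(ltW m0).
have mtail (M : R) n (W : 'I_n -> R) : (p < n)%N ->
    measurable [set w | M <= \sum_i W i * `|Z n w i 0|].
  by move=> pn; exact: measurable_weighted_sum_ge (Z_gaussian n pn) W M.
have nested_alpha n w : (p < n)%N -> alpha_hat n w \in nested_models p.
  by move=> pn; case: (alpha_hat_gic n pn w).
split.
  (* Claim (i): outside an event of probability at most [e], twice the gain in log-likelihood of any
     model is at most [C (C M)^2], which [tau n] eventually exceeds. *)
  move=> /cvgryPgt tau_oo; apply: cvg_probability1 => [|e e0].
    near=> n; split; first exact: measure_ge0.
    by apply/probability_le1/alpha_hat_meas; near: n; exact: nbhs_infty_gt.
  pose M := m * C / e.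
  have M0 : 0 < M by rewrite divr_gt0 ?mulr_gt0.
  near=> n.
  have pn : (p < n)%N by near: n; exact: nbhs_infty_gt.
  have [|W [W0 WC HW]] := HN0 n; first by near: n; exact: nbhs_infty_ge.
  have tau_n : C * (C * M) ^+ 2 < tau n by near: n; exact: tau_oo.
  pose E := [set w | M <= \sum_i W i * `|Z n w i 0|].
  have mE : measurable E by exact: mtail.
  have PE : (P n E <= e%:E)%E.
    apply: (le_trans (tail M n W M0 pn W0 WC)).
    by rewrite lee_fin /M invf_div mulrCA divff ?mulr1// gt_eqF// mulr_gt0.
  apply: (@le_trans _ _ (P n (~` E))).
    by rewrite probability_setC// EFinB leeB.
  apply: le_measure; rewrite ?inE; [exact: measurableC|exact: alpha_hat_meas|].
  move=> w /negP; rewrite -ltNge => wM; apply/eqP/negPn/negP => a0.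
  pose a := alpha_hat n w; pose th := theta_hat n w a.
  have Tth : Theta th by case: (theta_hat_ml n pn w a (nested_alpha n w pn)).
  have := selected_penalty_le (theta_hat_ml n pn w) (alpha_hat_gic n pn w) Tth.
  rewrite -/a -/th; have [H1 H2 H3 H4] := HW th (box _ Tth) a.
  (* The data are not shifted here: with [b = 0], the error [t] bounds the fitted coefficients
     themselves. *)
  have := H1 finset.set0 (Z n w) 0 (C * M); rewrite mulmx0 subr0 => /(_ _) H.
  rewrite leNgt => /negP; apply.
  apply: (le_lt_trans (H _)) => [k|].
    rewrite sub0r mxE normrN (le_trans (H3 _ _))// ler_wpM2l ?(ltW C0)//; exact: ltW.
  apply: (lt_le_trans tau_n).
  rewrite ler_peMr//; last by rewrite ler1n card_gt0.
  by apply/ltW/(le_lt_trans _ tau_n); rewrite mulr_ge0 ?sqr_ge0 ?(ltW C0).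
(* Claim (ii): an event [G] that excludes the selection of [alpha0] is shown to have probability at
   least [delta] for all large [n]. *)
move=> a0 /limn_einf_gt0[c [c0 tau_c]].
pose a := alpha0; have ain : a \in nested_models p by case: alpha0_smallest.
pose r := (1 + #|a|)%N.
(* Mesh of the grid: rounding the coefficients costs at most [C eta^2 <= c/8]. The minimum with 1
   gives [eta^2 <= eta]. *)
pose eta := Num.min 1 (c / (8 * C)).
have eta0 : 0 < eta by rewrite lt_min ltr01 divr_gt0 ?mulr_gt0.
have etaC : C * eta ^+ 2 <= c / 8.
  have e1 : eta <= 1 by rewrite ge_min lexx.
  have e2 : eta <= c / (8 * C) by rewrite ge_min lexx orbT.
  have : eta ^+ 2 <= c / (8 * C).
    by apply: le_trans e2; rewrite expr2 ler_piMl// ltW.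
  rewrite -(ler_pM2l C0) => /le_trans; apply.
  by rewrite (_ : C * (c / (8 * C)) = c / 8)//; field; rewrite gt_eqF.
(* The tail bound [m C / M] becomes one half; [K] then makes the grid reach the size [C M] of the
   fitted coefficients. *)
pose M := 2 * m * C.
have M0 : 0 < M by rewrite !mulr_gt0.
pose K := (Num.truncn (C * M / eta)).+1.
have KP : C * M <= eta * K%:R.
  by rewrite [leRHS]mulrC -ler_pdivrMr//; exact: ltW (truncnS_gt _).
pose grid := {ffun 'I_r -> 'I_(2 * K).+1}.
pose b : grid -> 'cV[R]_r := grid_point eta.
pose D := C * (eta * K%:R) ^+ 2.
(* The remainders [expR D / lam] of the shift inequality add up to [1/4] over the grid; the other
   [1/4] of the covered mass yields [delta]. *)
pose lam := 4 * #|{: grid}|%:R * expR D.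
have N_gt0 : 0 < #|{: grid}|%:R :> R.
  by rewrite ltr0n; apply/card_gt0P; exists [ffun=> ord0].
have lam0 : 0 < lam by rewrite !mulr_gt0// expR_gt0.
pose delta := (4 * #|{: grid}|%:R * lam)^-1.
have delta0 : 0 < delta by rewrite invr_gt0 (mulr_gt0 (mulr_gt0 _ N_gt0) lam0).
apply: (@le_lt_trans _ _ (1 - delta)%:E); last by rewrite lte_fin gtrBl.
apply: limn_esup_le_near; near=> n.
have pn : (p < n)%N by near: n; exact: nbhs_infty_gt.
have [|W [W0 WC HW]] := HN0 n; first by near: n; exact: nbhs_infty_ge.
have tau_n : c <= tau n by near: n.
pose X := design_sub (@monomial R p) n a.
pose ll := loglik (@monomial R p) (n := n).
(* On [G] the maximized log-likelihood of [a] exceeds that of the empty model by less than [c/2]. *)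
pose G : set 'cV[R]_n := [set z | exists q : rat, (forall t, Theta t -> ll z a t <= ratr q) /\
    exists t, Theta t /\ ratr q - c / 2 < ll z finset.set0 t].
have mG u B : <<s @boxes R n >> [set x | G (u + B *m x)].
  by apply: boxes_dominated => t; exact: continuous_loglik_affine.
have mGZ u : measurable [set w | G (Z n w - u)].
  have -> : [set w | G (Z n w - u)] = (fun w => Z n w - u) @^-1` G by [].
  apply: measurable_box_preimage => [i|].
    under eq_fun do rewrite mxE; apply: measurable_funD => //.
    exact: gaussian_vector_measurable (Z_gaussian n pn) i.
  have := mG 0 1%:M; rewrite (_ : [set _ | _] = G)//.
  by apply/seteqP; split => x /=; rewrite add0r mul1mx.
pose E := [set w | M <= \sum_i W i * `|Z n w i 0|].
have mE : measurable E by exact: mtail.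
have PE : (P n E <= (2^-1)%:E)%E.
  apply: (le_trans (tail M n W M0 pn W0 WC)).
  rewrite lee_fin (_ : m * C / M = 2^-1)// /M; field.
  by rewrite !gt_eqF.
(* Off E the fitted coefficients lie within eta of a grid point, whose mean moves the data into G. *)
pose l0 : grid := [ffun=> ord0].
pose A i := [set w | G (Z n w - X *m b (nth l0 (enum {: grid}) i))].
have cover : ~` E `<=` \big[setU/set0]_(i < #|{: grid}|) A i.
  move=> w /negP; rewrite -ltNge => wM.
  pose th := theta_hat n w a.
  have [Tth thmax] := theta_hat_ml n pn w a ain.
  have [H1 H2 H3 H4] := HW th (box _ Tth) a.
  pose g := gls_coef (invmx (covmx n th)) X (Z n w).
  have gK k : `|g k 0| <= eta * K%:R.
    apply: le_trans KP; apply: (le_trans (H3 _ k)).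
    by rewrite ler_wpM2l ?(ltW C0)// ltW.
  have [l lP] := grid_point_approx eta0 gK.
  rewrite -bigcup_mkord; exists (index l (enum {: grid})).
    by rewrite /= [X in (_ < X)%N]cardE index_mem mem_enum.
  rewrite /A /= nth_index ?mem_enum//.
  have := H1 finset.set0 (Z n w) (b l) eta lP; rewrite -/X -/(ll _ _ _) -/(ll _ _ _) => Hd.
  (* The threshold [q] exceeds the maximum by less than [c/8] and the rounding costs at most [c/16],
     together less than [c/2]. *)
  have lt8 : ll (Z n w) a th < ll (Z n w) a th + c / 8 by rewrite ltrDl divr_gt0.
  have [q] := rat_in_itvoo lt8.
  rewrite in_itv /= => /andP[q1 q2].
  exists q; split.
    (* The shift leaves the likelihood of [a] unchanged, so its maximum is still attained at
       [th]. *)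
    move=> t Tt; have [_ H2' _ _] := HW t (box _ Tt) a.
    have := H2' (Z n w) (b l); rewrite -/X -/ll => ->.
    apply: le_trans (ltW q1).
    exact: (ml_ge (theta_hat_ml n pn w) ain Tt).
  exists th; split => //; move: Hd etaC q2.
  lra.
(* On [G], twice the gain is below [c], while the penalty [tau n #|a|] is at least [c] because [a]
   is nonempty. *)
have G_not_selected : [set w | G (Z n w)] `<=` ~` [set w | alpha_hat n w = a].
  move=> w [q [q1 [t [Tt q2]]]] /= wa.
  have := selected_penalty_le (theta_hat_ml n pn w) (alpha_hat_gic n pn w) Tt.
  have [Tth _] := theta_hat_ml n pn w a ain.
  rewrite wa; have := q1 _ Tth; rewrite /ll in q2 * => q3 q4.
  have : c <= tau n * #|a|%:R.
    apply: (le_trans tau_n); rewrite ler_peMr ?(le_trans (ltW c0))//.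
    by rewrite ler1n card_gt0; apply/eqP.
  lra.
(* The events [A i] cover a set of probability at least one half, and each is compared with [G] by
   the shift inequality. *)
have PG_ge : (delta%:E <= P n [set w | G (Z n w)])%E.
  have Pshift i : (P n (A i) <= lam%:E * P n [set w | G (Z n w)] + (expR D / lam)%:E)%E.
    have pS := in_box_posdef n lo0 (box _ theta0_in).
    have [H1 H2 H3 H4] := HW _ (box _ theta0_in) a.
    pose u := X *m b (nth l0 (enum {: grid}) i).
    have := gaussian_vector_shift_le (Z_gaussian n pn) u (G := G) (posdef_unitmx pS)
      (proj1 pS) lam0 mG.
    move=> /le_trans; apply; rewrite leeD2l// lee_fin ler_wpM2r ?invr_ge0 ?(ltW lam0)//.
    rewrite ler_expR; apply: H4 => k; exact: grid_point_le.
  have mA i : measurable (A i) by exact: mGZ.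
  have half : ((2^-1)%:E <= P n (~` E))%E.
    rewrite probability_setC// (_ : 2^-1 = 1 - 2^-1 :> R); last by field.
    by rewrite EFinB leeB.
  have mU : measurable (\big[setU/set0]_(i < #|{: grid}|) A i).
    by apply: bigsetU_measurable => i _.
  have mGn : measurable [set w | G (Z n w)].
    by have := mGZ 0; under eq_set do rewrite subr0.
  have Pfin : P n [set w | G (Z n w)] \is a fin_num by exact: fin_num_measure.
  have bound : (P n (~` E) <= \sum_(i < #|{: grid}|)
      (lam%:E * P n [set w | G (Z n w)] + (expR D / lam)%:E))%E.
    apply: (@le_trans _ _ (P n (\big[setU/set0]_(i < #|{: grid}|) A i))).
      by apply: le_measure => //; rewrite ?inE//; exact: measurableC.
    apply: (le_trans (Boole_inequality _ _)) => //.
    by apply: lee_sum => i _; exact: Pshift.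
  have := le_trans half bound; rewrite -(fineK Pfin) -EFinM -EFinD sumEFin !lee_fin.
  rewrite sumr_const card_ord -[(_ + _) *+ _]mulr_natl; move: (fine _) => x.
  have -> : #|{: grid}|%:R * (lam * x + expR D / lam) = #|{: grid}|%:R * lam * x + 4^-1.
    by rewrite /lam; field; rewrite !gt_eqF ?expR_gt0.
  move=> hx; rewrite /delta -div1r ler_pdivrMr; last by rewrite (mulr_gt0 (mulr_gt0 _ N_gt0) lam0).
  rewrite (_ : x * _ = 4 * (#|{: grid}|%:R * lam * x)); last by ring.
  by move: hx; move: (#|{: grid}|%:R * lam * x) => y hy; lra.
have mGn : measurable [set w | G (Z n w)].
  by have := mGZ 0; under eq_set do rewrite subr0.
have mSel : measurable [set w | alpha_hat n w = a] by exact: alpha_hat_meas.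
have : (P n [set w | G (Z n w)] <= P n (~` [set w | alpha_hat n w = a]))%E.
  by apply: le_measure => //; rewrite ?inE//; exact: measurableC.
rewrite probability_setC// => /(le_trans PG_ge).
have Pfin : P n [set w | alpha_hat n w = a] \is a fin_num by exact: fin_num_measure.
by rewrite -(fineK Pfin) -EFinB !lee_fin => h; lra.
Unshelve. all: by end_near.
Qed.
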